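(* Let $a\geq 0$ and $b\in\mathbb{R}$, $b\neq 0$, be constants and let $f\in L^{2}(\mathbb{R})$. Consider the equation $$-\frac{d^{2}u}{dx^{2}}+\frac{d^{4}u}{dx^{4}}-b\frac{du}{dx}-au=f(x),\quad x\in\mathbb{R}. \qquad (\ast)$$ a) If $a>0$, then $(\ast)$ has a unique solution $u\in H^{4}(\mathbb{R})$. b) If $a=0$ and in addition $xf(x)\in L^{1}(\mathbb{R})$, then $(\ast)$ admits a unique solution $u\in H^{4}(\mathbb{R})$ if and only if the orthogonality relation $(f(x),1)_{L^{2}(\mathbb{R})}=0$ holds.
   Context: Functions are complex-valued. $H^{4}(\mathbb{R})$ is the usual Sobolev space, equipped with the norm $\|u\|_{H^{4}(\mathbb{R})}^{2}:=\|u\|_{L^{2}(\mathbb{R})}^{2}+\left\|\frac{d^{4}u}{dx^{4}}\right\|_{L^{2}(\mathbb{R})}^{2}$; the equation is understood as an equality in $L^{2}(\mathbb{R})$. The notation $(f,g)_{L^{2}(\mathbb{R})}:=\int_{-\infty}^{\infty}f(x)\overline{g(x)}\,dx$ is also used when $f\in L^{1}(\mathbb{R})$ and $g$ is bounded, so $(f(x),1)_{L^{2}(\mathbb{R})}=\int_{-\infty}^{\infty}f(x)\,dx$; this is well defined when $f\in L^{2}(\mathbb{R})$ and $xf(x)\in L^{1}(\mathbb{R})$, since then $f\in L^{1}(\mathbb{R})$. *)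

(* Defs.v *)
From HB Require Import structures.
From mathcomp Require Import all_boot all_order all_algebra.
From mathcomp Require Import all_classical all_reals all_analysis.
From mathcomp Require Export complex.

Set Implicit Arguments.
Unset Strict Implicit.
Unset Printing Implicit Defensive.
Import Order.TTheory GRing.Theory Num.Theory.
Import numFieldNormedType.Exports.

Local Open Scope classical_set_scope.
Local Open Scope complex_scope.
Local Open Scope ring_scope.

(* Functions R -> R[i] stand for their almost-everywhere classes: every notion
   below is invariant under modification on a Lebesgue-null set (among
   measurable functions), and uniqueness is stated up to such modification. *)

(* The library has no sigma-algebra on R[i]; this is Borel measurability for
   the identification of R[i] with R * R. *)
Definition cmeasurable {R : realType} (f : R -> R[i]) : Prop :=
  measurable_fun [set: R] (fun x => complex.Re (f x)) /\
  measurable_fun [set: R] (fun x => complex.Im (f x)).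

Definition cLp {R : realType} (p : \bar R) (f : R -> R[i]) : Prop :=
  cmeasurable f /\
  finite_norm (@lebesgue_measure R) p (fun x => Normc.normc (f x)).

Definition cintegral {R : realType} (f : R -> R[i]) : R[i] :=
  (\int[@lebesgue_measure R]_x complex.Re (f x)) +i*
  (\int[@lebesgue_measure R]_x complex.Im (f x)).

Definition L2dot {R : realType} (f g : R -> R[i]) : R[i] :=
  cintegral (fun x => f x * ((g x)^*)%C).

Definition test_function {R : realType} (phi : R -> R) : Prop :=
  (forall (n : nat) (x : R), derivable (derive1n n phi) x 1) /\
  compact (closure [set x | phi x != 0]).

(* By linearity, real-valued test functions give the same weak derivatives as
   complex-valued ones.  The integrals are meaningful for u and v locally
   integrable; below u and v are always in L^2. *)
Definition weak_derivative {R : realType} (n : nat) (u v : R -> R[i]) : Prop :=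
  forall phi : R -> R, test_function phi ->
    cintegral (fun x => u x * (derive1n n phi x)%:C) =
    (-1) ^+ n * cintegral (fun x => v x * (phi x)%:C).

(* Only membership in H^k is used, so the choice of norm plays no role. *)
Definition sobolevH {R : realType} (k : nat) (u : R -> R[i]) : Prop :=
  cLp 2%:E u /\
  forall n : nat, (n <= k)%N ->
    exists2 v : R -> R[i], cLp 2%:E v & weak_derivative n u v.

Definition H4_solution {R : realType} (a b : R) (f u : R -> R[i]) : Prop :=
  sobolevH 4 u /\
  exists d1 d2 d4 : R -> R[i],
    [/\ cLp 2%:E d1 /\ weak_derivative 1 u d1,
        cLp 2%:E d2 /\ weak_derivative 2 u d2,
        cLp 2%:E d4 /\ weak_derivative 4 u d4 &
        {ae @lebesgue_measure R, forall x,
          - d2 x + d4 x - b%:C * d1 x - a%:C * u x = f x}].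

Definition unique_ae {R : realType} (P : (R -> R[i]) -> Prop) : Prop :=
  exists u : R -> R[i], P u /\
    forall v : R -> R[i], P v ->
      {ae @lebesgue_measure R, forall x, v x = u x}.

(* Main.v *)
Require Import Defs.
From mathcomp Require Import all_boot all_order all_algebra.
From mathcomp Require Import all_classical all_reals all_analysis.
From mathcomp Require Import measurable_realfun ring lra.
Import Order.TTheory GRing.Theory Num.Theory.
Import numFieldNormedType.Exports.
Local Open Scope classical_set_scope.
Local Open Scope complex_scope.
Local Open Scope ring_scope.

(** The operator has constant coefficients, so it factors over the complex numbers
    as a product of four first-order operators d/dx - l, where l runs over the
    roots of X^4 - X^2 - b X - a, and the theorem reduces to first-order equations
    in L2.

    - Uniqueness: d/dx - l is injective in L2 for every l (L2deriv_root), since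
      v' = l v forces v to be a multiple of exp(l x), which is not square
      integrable. This rests on the lemma of du Bois-Reymond (du_Bois_Reymond):
      a locally integrable function with zero weak derivative is constant.
    - Existence: if Re l <> 0, then u' = l u + g is solved in L2 by integrating g
      against the fundamental solution exp(l (x - t)) supported on the half-line
      where it decays (L2deriv_solve). It is a weak solution by Fubini's theorem
      (kernel_wderiv) and lies in L2 by Schur's test (schur_L2). A rotation by
      exp(i Im(l) x) reduces everything to real coefficients and real functions.
    - Roots: as b <> 0, an imaginary root i q satisfies b q = 0, so the only
      possible one is 0, and it occurs only for a = 0
      (symbol_imaginary_root). For a > 0 the four first-order equations are
      solved successively.
    - For a = 0 the root 0 is simple and contributes the factor d/dx. If f has mean
      zero and x f is integrable, then f has a primitive in L2 (primitive_L2),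
      and the other three factors are inverted as before. Conversely,
      f is the weak derivative of u''' - u' - b u, which is in L2, and an
      integrable weak derivative of an L2 function has mean zero
      (wderiv_mean0). *)

Set Implicit Arguments.
Unset Strict Implicit.
Unset Printing Implicit Defensive.

(** * Smooth functions and test functions *)

Section Smooth.
Variable R : realType.
Implicit Types f g : R -> R.

Definition smooth f : Prop :=
  forall (n : nat) (x : R), derivable (derive1n n f) x 1.

(** All iterated derivatives stay inside a family closed under derivation. This
    replaces a Leibniz formula for higher derivatives: it suffices to exhibit
    such a family around the function of interest. *)
Lemma smooth_family (S : (R -> R) -> Prop) f :
  (forall g, S g -> (forall x, derivable g x 1) /\ S (derive1 g)) -> S f -> smooth f.
Proof.
move=> Sd Sf n; suff Sn : S (derive1n n f) by have [] := Sd _ Sn.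
by elim: n => [//|n IH]; rewrite derive1nS; have [] := Sd _ IH.
Qed.

Lemma smooth_derivable f (x : R) : smooth f -> derivable f x 1.
Proof. by move=> /(_ 0 x). Qed.

Lemma smooth_derive1n n f : smooth f -> smooth (derive1n n f).
Proof.
move=> sf k x; have := sf (k + n)%N x.
by rewrite /derive1n iterD.
Qed.

Lemma smooth_derive1 f : smooth f -> smooth (derive1 f).
Proof. exact: (@smooth_derive1n 1). Qed.

Lemma smooth_is_derive f (x : R) : smooth f -> is_derive x 1 f (derive1 f x).
Proof. by move=> sf; rewrite derive1E; apply/derivableP/smooth_derivable. Qed.

Lemma smooth_continuous f : smooth f -> continuous f.
Proof.
by move=> sf x; apply/differentiable_continuous/derivable1_diffP/smooth_derivable.
Qed.

Lemma smooth_cst (c : R) : smooth (fun=> c).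
Proof.
apply: (@smooth_family (fun h => exists c, h = cst c)); last by exists c.
move=> _ [d ->]; split=> [x|]; first exact: derivable_cst.
by exists 0; apply/funext => x; rewrite derive1_cst.
Qed.

(** The family used to prove closure of smoothness under sums, products and
    affine substitutions: the usual rules of calculus say that it is closed
    under derivation. *)
Inductive smooth_expr : (R -> R) -> Prop :=
| SE_base f : smooth f -> smooth_expr f
| SE_add f g : smooth_expr f -> smooth_expr g -> smooth_expr (f \+ g)
| SE_mul f g : smooth_expr f -> smooth_expr g -> smooth_expr (f \* g)
| SE_affine f (s t : R) : smooth_expr f -> smooth_expr (fun x => f (s * x + t)).

Lemma is_derive_affine f (s t x d : R) : is_derive (s * x + t) 1 f d ->
  is_derive x 1 (fun y => f (s * y + t)) (s * d).
Proof.
move=> fd; have ad : is_derive x 1 (fun y => s * y + t) s.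
  apply: is_derive_eq.
  by rewrite addr0 /GRing.scale /= mulr1.
by have := @is_derive1_comp R f (fun y => s * y + t) x d s fd ad; rewrite mulrC.
Qed.

Lemma smooth_expr_derive f : smooth_expr f ->
  (forall x, derivable f x 1) /\ smooth_expr (derive1 f).
Proof.
have derivE (h h' : R -> R) : (forall x : R, is_derive x 1 h (h' x)) ->
    (forall x, derivable h x 1) /\ derive1 h = h'.
  move=> hh; split=> [x|]; first by have [] := hh x.
  by apply/funext => x; rewrite derive1E; exact: derive_val.
have isd (h : R -> R) (x : R) : derivable h x 1 -> is_derive x 1 h (derive1 h x).
  by move=> dh; rewrite derive1E; exact/derivableP.
elim=> {f} [f sf|f g _ [df sf] _ [dg sg]|f g sef [df sf] seg [dg sg]
           |f s t sef [df sf]].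
- by split=> [x|]; [exact: smooth_derivable|exact/SE_base/smooth_derive1].
- have [|dfg ->] := derivE (f \+ g) (derive1 f \+ derive1 g); last first.
    by split => //; exact: SE_add.
  by move=> x; have ? := isd _ _ (df x); have ? := isd _ _ (dg x); exact: is_deriveD.
- have [|dfg ->] := derivE (f \* g) ((f \* derive1 g) \+ (g \* derive1 f)); last first.
    by split => //; apply: SE_add; exact: SE_mul.
  by move=> x; have ? := isd _ _ (df x); have ? := isd _ _ (dg x); exact: is_deriveM.
- have [|dfg ->] := derivE (fun x => f (s * x + t))
    (cst s \* (fun x => derive1 f (s * x + t))); last first.
    by split => //; apply: SE_mul; [exact/SE_base/smooth_cst|exact: SE_affine].
  by move=> x; exact/is_derive_affine/isd.
Qed.

Lemma smooth_exprP f : smooth_expr f -> smooth f.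
Proof. exact: (smooth_family smooth_expr_derive). Qed.

Lemma smoothD f g : smooth f -> smooth g -> smooth (fun x => f x + g x).
Proof. by move=> sf sg; apply/smooth_exprP/SE_add; exact: SE_base. Qed.

Lemma smoothM f g : smooth f -> smooth g -> smooth (fun x => f x * g x).
Proof. by move=> sf sg; apply/smooth_exprP/SE_mul; exact: SE_base. Qed.

Lemma smooth_affine f (s t : R) : smooth f -> smooth (fun x => f (s * x + t)).
Proof. by move=> sf; apply/smooth_exprP/SE_affine; exact: SE_base. Qed.

Lemma smooth_expR : smooth (@expR R).
Proof.
apply: (@smooth_family (fun h => h = expR)) => // _ ->; split=> [x|].
  by have [] := is_derive_expR x.
by apply/funext => x; rewrite derive1E; exact: derive_val.
Qed.

Lemma smooth_trig (p q : R) : smooth (fun x => p * cos x + q * sin x).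
Proof.
pose S h := exists p q : R, h = (fun x => p * cos x + q * sin x).
apply: (@smooth_family S); last by exists p, q.
move=> _ [c [d ->]].
have dcd (x : R) : is_derive x 1 (fun x : R => c * cos x + d * sin x) (d * cos x + (- c) * sin x).
  apply: is_derive_eq.
  by rewrite /GRing.scale /= mulrN mulNr addrC.
split=> [x|]; first by have [] := dcd x.
by exists d, (- c); apply/funext => x; rewrite derive1E; exact: derive_val.
Qed.

Lemma smooth_cos b : smooth (fun x : R => cos (b * x)).
Proof.
have /(@smooth_affine _ b 0) := @smooth_trig 1 0; congr smooth.
by apply/funext => x; rewrite mul1r mul0r !addr0.
Qed.

Lemma smooth_sin b : smooth (fun x : R => sin (b * x)).
Proof.
have /(@smooth_affine _ b 0) := @smooth_trig 0 1; congr smooth.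
by apply/funext => x; rewrite mul0r mul1r add0r addr0.
Qed.

Lemma smooth_expRM b : smooth (fun x : R => expR (b * x)).
Proof.
have /(@smooth_affine _ b 0) := smooth_expR; congr smooth.
by apply/funext => x; rewrite addr0.
Qed.

Lemma derive1_scale f (b x d : R) : is_derive (b * x) 1 f d ->
  derive1 (fun y => f (b * y)) x = b * d.
Proof.
move=> fd; have := @is_derive_affine f b 0 x d; rewrite addr0 => /(_ fd).
have -> : (fun y => f (b * y + 0)) = (fun y => f (b * y)).
  by apply/funext => y; rewrite addr0.
by move=> ?; rewrite derive1E; exact: derive_val.
Qed.

Lemma derive1_expRM (b x : R) :
  derive1 (fun x => expR (b * x)) x = b * expR (b * x).
Proof. exact: derive1_scale. Qed.

Lemma derive1_cos (b x : R) :
  derive1 (fun x => cos (b * x)) x = - (b * sin (b * x)).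
Proof. by rewrite -mulrN; apply: derive1_scale. Qed.

Lemma derive1_sin (b x : R) :
  derive1 (fun x => sin (b * x)) x = b * cos (b * x).
Proof. exact: derive1_scale. Qed.

(** With q = 1 this is the standard function that is flat at 0. The factor q(1/x)
    makes the family closed under derivation, whence its smoothness. *)
Definition flat (q : {poly R}) (x : R) : R :=
  if 0 < x then q.[x^-1] * expR (- x^-1) else 0.

Lemma poly_bound (q : {poly R}) :
  exists (C : R) (n : nat), 0 <= C /\ forall y, 1 <= y -> `|q.[y]| <= C * y ^+ n.
Proof.
elim/poly_ind: q => [|p c [C [n [C0 IH]]]].
  by exists 0, 0%N; split => // y _; rewrite horner0 normr0 mul0r.
exists (C + `|c|), n.+1; split; first by rewrite addr_ge0.
move=> y y1; have y0 : 0 <= y by exact: le_trans y1.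
rewrite hornerD hornerMX hornerC mulrDl (le_trans (ler_normD _ _))// lerD//.
  by rewrite normrM (ger0_norm y0) exprSr mulrA ler_wpM2r// IH.
by rewrite ler_peMr// exprn_ege1.
Qed.

(** The exponential beats every power of 1/x; the quadratic rate is what gives
    differentiability at 0 with derivative 0. *)
Lemma flat_bound q : exists C : R, 0 <= C /\ forall x, x <= 1 -> `|flat q x| <= C * x ^+ 2.
Proof.
have [C [n [C0 Cq]]] := poly_bound q.
exists (C * (n.+2)`!%:R); split; first by rewrite mulr_ge0.
move=> x x1; rewrite /flat; case: ifPn => [x0|_]; last first.
  by rewrite normr0 mulr_ge0 ?sqr_ge0// mulr_ge0.
set y := x^-1; have y1 : 1 <= y by rewrite /y -[leLHS]invr1 lef_pV2 ?posrE.
have y0 : 0 < y by rewrite invr_gt0.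
rewrite normrM [`|expR _|]ger0_norm ?expR_ge0// expRN.
have eb : (expR y)^-1 <= (n.+2)`!%:R * y ^- n.+2.
  rewrite -[leRHS]invrK lef_pV2 ?posrE ?expR_gt0 ?invr_gt0 ?mulr_gt0 ?invr_gt0 ?exprn_gt0 ?ltr0n ?fact_gt0//.
  rewrite invfM invrK mulrC; apply: le_trans (expR_ge1Dxn n.+1 (ltW y0)).
  by rewrite lerDr.
apply: (@le_trans _ _ ((C * y ^+ n) * ((n.+2)`!%:R * y ^- n.+2))).
  by rewrite ler_pM// ?invr_ge0 ?expR_ge0// Cq.
rewrite le_eqVlt; apply/orP; left; apply/eqP.
have -> : y ^- n.+2 = y ^- n * x ^+ 2.
  by rewrite -addn2 exprD invfM; congr (_ * _); rewrite -exprVn /y invrK.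
have yn : y ^+ n != 0 by rewrite expf_neq0// gt_eqF.
rewrite -!mulrA; congr (_ * _); rewrite mulrCA; congr (_ * _).
by rewrite mulrA mulfV ?mul1r.
Qed.

Lemma is_derive_flat q (x : R) :
  is_derive x 1 (flat q) (flat ('X^2 * (q - q^`()%R)) x).
Proof.
have [x0|x0|x0] := ltgtP 0 x.
- have xn : x != 0 by rewrite gt_eqF.
  have d1 : is_derive x 1 (fun y : R => y^-1) (- x ^- 2).
    apply: is_derive_eq; first exact: (@is_deriveV _ id _ _ 1).
    by rewrite /GRing.scale /= mulr1.
  have d2 := @is_derive1_comp R (horner q) (fun y : R => y^-1) x _ _ (is_derive_poly q _) d1.
  have d3 : is_derive x 1 (fun y : R => expR (- y^-1)) (expR (- x^-1) * x ^- 2).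
    have dN : is_derive x 1 (fun y : R => - y^-1) (x ^- 2).
      by have := @is_deriveN _ _ _ (fun y : R => y^-1) x 1 _ d1; rewrite opprK.
    exact: (@is_derive1_comp R expR (fun y : R => - y^-1) x _ _ (is_derive_expR _)).
  have d4 := @is_deriveM _ _ _ _ _ _ _ _ d2 d3.
  rewrite /flat x0.
  apply: (@near_eq_is_derive _ _ _ (fun y : R => q.[y^-1] * expR (- y^-1))).
    near=> y; rewrite ifT//; near: y; exact: lt_nbhsr.
  move: d4; congr is_derive.
  by rewrite !hornerE /GRing.scale /= -exprVn; ring.
- have -> : flat ('X^2 * (q - q^`()%R)) x = 0.
    by rewrite /flat ltNge (ltW x0).
  apply: (@near_eq_is_derive _ _ _ (cst 0)) => //.
  near=> y; rewrite /flat ifF//; apply/negbTE; rewrite -leNgt ltW//.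
  by near: y; exact: lt_nbhsl.
- rewrite -x0 {2}/flat ltxx.
  have [C [C0 Cf]] := flat_bound q.
  have cv : h^-1 *: ((flat q \o shift 0) (h *: 1) - flat q 0) @[h --> 0^'] --> (0 : R).
    apply/cvgrPdist_le => e e0; near=> h.
    rewrite sub0r normrN {2}/flat ltxx subr0 /= addr0 /GRing.scale /= mulr1 normrM normfV.
    have h0 : h != 0 by near: h; exact: nbhs_dnbhs_neq.
    have h1 : `|h| <= 1 by near: h; apply: dnbhs0_le.
    rewrite ler_pdivrMl ?normr_gt0//; apply: (le_trans (Cf _ _)).
      exact: le_trans (ler_norm _) h1.
    rewrite -real_normK ?num_real// expr2 mulrCA ler_wpM2l//.
    rewrite (@le_trans _ _ ((C + 1) * `|h|))//.
      by rewrite ler_wpM2r// lerDl.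
    rewrite -ler_pdivlMl ?ltr_pwDr// mulrC; near: h; apply: dnbhs0_le.
    by rewrite divr_gt0// ltr_pwDr.
  apply: DeriveDef; first by apply/cvg_ex; exists 0; exact: cv.
  by apply/cvg_lim => //; exact: cv.
Unshelve. all: by end_near. Qed.

Lemma smooth_flat q : smooth (flat q).
Proof.
apply: (@smooth_family (fun h => exists q, h = flat q)); last by exists q.
move=> _ [p ->]; split=> [x|]; first by have [] := is_derive_flat p x.
exists ('X^2 * (p - p^`()%R)); apply/funext => x.
by rewrite derive1E; apply: derive_val; exact: is_derive_flat.
Qed.

End Smooth.

(** * Test functions and local integrability *)

Section TestFunctions.
Variable R : realType.
Implicit Types f g h phi psi : R -> R.
Notation mu := (@lebesgue_measure R).

(** Compact support in the form used below: vanishing outside a bounded segment. *)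
Lemma test_functionP phi : test_function phi <->
  smooth phi /\ exists M : R, 0 < M /\ forall x, M <= `|x| -> phi x = 0.
Proof.
split=> [[sphi cphi]|[sphi [M [M0 phiM]]]].
  split=> //; have [N [_ hN]] := compact_bounded cphi.
  exists (`|N| + 1); split=> [|x Nx]; first by rewrite ltr_pwDr.
  apply/eqP; apply: contraTT Nx => phix; rewrite -ltNge.
  have Nx := hN (`|N| + 2^-1) _ x (@subset_closure _ [set x | phi x != 0] x phix).
  have lt1 : N < `|N| + 2^-1 by rewrite (le_lt_trans (ler_norm N))// ltrDl invr_gt0.
  by rewrite (le_lt_trans (Nx lt1))// ltrD2l invf_lt1// ltr1n.
split=> //; apply: (subclosed_compact _ (@segment_compact R (- M) M)) => //.
  exact: closed_closure.
have cI : closed (`[- M, M]%classic : set R^o) by exact (@interval_closed R (BLeft (- M)) (BRight M) isT isT).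
rewrite ((closure_id _).1 cI).
apply: closureS => x /= phix; rewrite in_itv /= -ler_norml leNgt.
by apply: contra phix => /ltW/phiM/eqP.
Qed.

Lemma test_smooth phi : test_function phi -> smooth phi.
Proof. by move=> /test_functionP[]. Qed.

Lemma test_continuous phi : test_function phi -> continuous phi.
Proof. by move=> /test_smooth; exact: smooth_continuous. Qed.

Lemma test_derive1 phi : test_function phi -> test_function (derive1 phi).
Proof.
move=> /test_functionP[sphi [M [M0 phiM]]]; apply/test_functionP; split.
  exact: smooth_derive1.
exists (M + 1); split=> [|x Mx]; first by rewrite addr_gt0.
have cst0 : is_derive x 1 (cst 0 : R -> R) 0 by exact: is_derive_cst.
rewrite derive1E; apply: derive_val; apply: (near_eq_is_derive _ cst0).
near=> y; rewrite phiM//=.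
have yx : ball x 1 y by near: y; exact: nbhsx_ballx.
move: yx; rewrite /ball /= => yx; have := ler_normD (x - y) y; rewrite subrK; lra.
Unshelve. all: by end_near. Qed.

Lemma test_derive1n n phi : test_function phi -> test_function (derive1n n phi).
Proof.
by move=> tphi; elim: n => [//|n IH]; rewrite derive1nS; exact: test_derive1.
Qed.

Lemma test_mul f phi : smooth f -> test_function phi ->
  test_function (fun x => f x * phi x).
Proof.
move=> sf /test_functionP[sphi [M [M0 phiM]]]; apply/test_functionP; split.
  exact: smoothM.
by exists M; split=> // x /phiM ->; rewrite mulr0.
Qed.

Lemma testD phi psi : test_function phi -> test_function psi ->
  test_function (fun x => phi x + psi x).
Proof.
move=> /test_functionP[sphi [M [M0 phiM]]] /test_functionP[spsi [N [N0 psiN]]].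
apply/test_functionP; split; first exact: smoothD.
exists (Num.max M N); split=> [|x]; first by rewrite lt_max M0.
by rewrite ge_max => /andP[/phiM -> /psiN ->]; rewrite addr0.
Qed.

Lemma testZ (c : R) phi : test_function phi -> test_function (fun x => c * phi x).
Proof. by move=> tphi; apply: test_mul => //; exact: smooth_cst. Qed.

Lemma test_bounded phi : test_function phi ->
  exists B : R, 0 < B /\ forall x, `|phi x| <= B.
Proof.
move=> /[dup] tphi /test_functionP[_ [M [M0 phiM]]].
have cn : {within `[- M, M], continuous (fun x => `|phi x|)}.
  by apply: continuous_subspaceT => x; apply: continuous_comp;
    [exact: test_continuous|exact: norm_continuous].
have [|c _ cmax] := @EVT_max _ (fun x => `|phi x|) (- M) M _ cn; first lra.
exists (`|phi c| + 1); split=> [|x]; first by rewrite ltr_pwDr.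
have [/phiM->|] := leP M `|x|; first by rewrite normr0 addr_ge0.
by move=> /ltW; rewrite ler_norml => xM; rewrite (le_trans (cmax x _))// lerDl.
Qed.

(** Only symmetric segments are used, as they exhaust the line; this is
    equivalent to integrability on all compact sets (locint_locally). *)
Definition locint h := measurable_fun setT h /\
  forall M : R, mu.-integrable `[- M, M] (EFin \o h).

Lemma locint_locally h : locint h -> locally_integrable setT h.
Proof.
move=> [mh hM]; split=> [//||K _ cK]; first exact: openT.
have [N [_ hN]] := compact_bounded cK.
have := hM (`|N| + 1) => /integrableP[_]; apply: le_lt_trans.
apply: ge0_subset_integral => //=; first exact: compact_measurable.
  by do 2 apply: measurableT_comp => //; exact: measurable_funTS.
move=> x Kx; rewrite /= in_itv /= -ler_norml; apply: hN => //.
by rewrite (le_lt_trans (ler_norm N))// ltrDl.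
Qed.

Lemma locint_segment h (a b : R) : locint h -> mu.-integrable `[a, b] (EFin \o h).
Proof.
move=> [_ hM]; set K := Num.max `|a| `|b|.
apply: integrableS (hM K) => // x.
have aK : `|a| <= K by rewrite le_max lexx.
have bK : `|b| <= K by rewrite le_max lexx orbT.
rewrite /= !in_itv /=; have := ler_norm b; have := ler_norm (- a); rewrite normrN.
by move=> ? ? /andP[? ?]; apply/andP; split; lra.
Qed.

Lemma continuous_locint f : continuous f -> locint f.
Proof.
move=> cf; split; first exact: continuous_measurable_fun.
move=> M; apply: continuous_compact_integrable; first exact: segment_compact.
exact: continuous_subspaceT.
Qed.

Lemma locintM h f : locint h -> continuous f -> locint (fun x => h x * f x).
Proof.
move=> [mh hM] cf; split.
  by apply: measurable_funM => //; exact: continuous_measurable_fun.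
move=> M; have cfM : {within `[- M, M], continuous f} by exact: continuous_subspaceT.
have /compact_bounded[N [_ hN]] := continuous_compact cfM (@segment_compact _ (- M) M).
have := @integrableMl _ _ _ mu `[- M, M]%classic _ (EFin \o h) f (hM M); apply => //.
  by apply: measurable_funTS; exact: continuous_measurable_fun.
by exists N; split; rewrite ?num_real // => y Ny x xM; apply: hN => //; exists x.
Qed.

Lemma locintD h f : locint h -> locint f -> locint (fun x => h x + f x).
Proof.
move=> [mh ih] [mf i_f]; split; first exact: measurable_funD.
by move=> M; have := integrableD _ (ih M) (i_f M); apply.
Qed.

Lemma integrable_test h phi : locint h -> test_function phi ->
  mu.-integrable setT (EFin \o (fun x => h x * phi x)).
Proof.
move=> lh /[dup] tphi /test_functionP[_ [M [M0 phiM]]].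
have [_ /(_ M)] := locintM lh (test_continuous tphi).
rewrite integrable_mkcond//; apply: eq_integrable => // x _.
rewrite patchE; case: ifPn => // /negP xM; rewrite /= phiM ?mulr0//.
rewrite leNgt; apply/negP => Mx; apply: xM; rewrite inE /= in_itv /= -ler_norml.
exact: ltW.
Qed.

End TestFunctions.

(** * The fundamental lemma and the lemma of du Bois-Reymond *)

Section FundamentalLemma.
Variable R : realType.
Implicit Types f g h phi psi : R -> R.
Notation mu := (@lebesgue_measure R).

Lemma ae_mono (P Q : R -> Prop) : (forall x, P x -> Q x) ->
  {ae mu, forall x, P x} -> {ae mu, forall x, Q x}.
Proof. by move=> PQ; apply: (@filterS _ _ (ae_filter_ringOfSetsType mu)). Qed.

Lemma ae_mono2 (P Q S : R -> Prop) : (forall x, P x -> Q x -> S x) ->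
  {ae mu, forall x, P x} -> {ae mu, forall x, Q x} -> {ae mu, forall x, S x}.
Proof. by move=> PQ; apply: (@filterS2 _ _ (ae_filter_ringOfSetsType mu)). Qed.

Lemma flat1_ge0 (y : R) : 0 <= flat 1 y.
Proof. by rewrite /flat; case: ifP => // _; rewrite hornerE mul1r expR_ge0. Qed.

Lemma flat1_le1 (y : R) : flat 1 y <= 1.
Proof.
rewrite /flat; case: ifP => // y0; rewrite hornerE mul1r -[leRHS]expR0 ler_expR.
by rewrite oppr_le0 invr_ge0 ltW.
Qed.

Lemma flat1_cvg (c : R) : 0 < c -> flat 1 (n.+1%:R * c) @[n --> \oo] --> (1 : R).
Proof.
move=> c0.
have -> : (fun n : nat => flat 1 (n.+1%:R * c)) = (fun n => expR (- (harmonic n * c^-1))).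
  by apply/funext => n; rewrite /flat mulr_gt0// hornerE mul1r invfM.
rewrite -expR0; apply: continuous_cvg; first exact: continuous_expR.
rewrite -oppr0 -(mul0r c^-1); apply: cvgN; apply: cvgMl.
exact: cvg_harmonic.
Qed.

(** Smooth functions between 0 and 1 that vanish outside ]a, b[ and tend
    pointwise to its indicator: exp(-1/(n y)) tends to 1 for every y > 0. *)
Definition box (a b : R) (n : nat) (x : R) : R :=
  flat 1 (n.+1%:R * (x - a)) * flat 1 (n.+1%:R * (b - x)).

Lemma flat1_neg (y : R) : y <= 0 -> flat 1 y = 0.
Proof. by rewrite /flat leNgt => /negbTE ->. Qed.

Lemma box_out a b n x : x <= a \/ b <= x -> box a b n x = 0.
Proof.
rewrite /box; move=> [xa|bx].
  by rewrite flat1_neg ?mul0r// mulr_ge0_le0// subr_le0.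
by rewrite mulrC flat1_neg ?mul0r// mulr_ge0_le0// subr_le0.
Qed.

Lemma box_norm a b n x : `|box a b n x| <= 1.
Proof.
rewrite /box normrM !ger0_norm ?flat1_ge0//.
by rewrite mulr_ile1// ?flat1_ge0// flat1_le1.
Qed.

Lemma test_box a b n : test_function (box a b n).
Proof.
apply/test_functionP; split.
  apply: smoothM.
    have := @smooth_affine _ (flat 1) n.+1%:R (- (n.+1%:R * a)) (@smooth_flat R 1).
    by congr smooth; apply/funext => x; congr flat; ring.
  have := @smooth_affine _ (flat 1) (- n.+1%:R) (n.+1%:R * b) (@smooth_flat R 1).
  by congr smooth; apply/funext => x; congr flat; ring.
exists (Num.max `|a| `|b| + 1); split=> [|x]; first by rewrite ltr_pwDr// le_max normr_ge0.
have aK : `|a| <= Num.max `|a| `|b| by rewrite le_max lexx.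
have bK : `|b| <= Num.max `|a| `|b| by rewrite le_max lexx orbT.
move=> xK; apply: box_out; have := ler_norm b; have := ler_norm (- a); rewrite normrN.
move: xK; have [x0|x0] := leP 0 x.
  by rewrite (ger0_norm x0) => *; right; lra.
by rewrite (ltr0_norm x0) => *; left; lra.
Qed.

Lemma box_cvg a b x : box a b n x @[n --> \oo] --> (\1_(`]a, b[%classic) x : R).
Proof.
rewrite indicE; case: (boolP (x \in _)) => xab /=.
  move: xab; rewrite inE /= in_itv /= => /andP[ax xb].
  by rewrite -(mulr1 1); apply: cvgM; apply: flat1_cvg; rewrite subr_gt0.
rewrite (_ : (fun n => _) = (fun=> 0)); first exact: cvg_cst.
apply/funext => n; apply: box_out.
have [xa|ax] := leP x a; first by left.
have [bx|xb] := leP b x; first by right.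
by move: xab; rewrite notin_setE /= in_itv /= ax xb.
Qed.

Lemma Rintegral_EFin (D : set R) f : measurable D -> mu.-integrable D (EFin \o f) ->
  (\int[mu]_(x in D) (f x)%:E)%E = (\int[mu]_(x in D) f x)%:E.
Proof. by move=> mD fi; rewrite /Rintegral fineK//; exact: integrable_fin_num. Qed.

(** Dominated convergence along the approximations of the indicator. *)
Lemma test_orthogonal_itv h a b : locint h ->
  (forall phi, test_function phi -> \int[mu]_x (h x * phi x) = 0) ->
  \int[mu]_(x in `]a, b[) h x = 0.
Proof.
move=> lh h0; have [mh hM] := lh.
set K := Num.max `|a| `|b|.
pose g x := `|(h \_ `[- K, K]) x|.
have ig : mu.-integrable setT (EFin \o g).
  have := hM K; rewrite integrable_mkcond//= restrict_EFin => /integrable_norm.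
  exact.
have fE n x : h x * box a b n x = (h \_ `[- K, K]) x * box a b n x.
  rewrite patchE; case: ifPn => // xK; rewrite box_out ?mulr0//.
  have aK : `|a| <= K by rewrite le_max lexx.
  have bK : `|b| <= K by rewrite le_max lexx orbT.
  have := ler_norm b; have := ler_norm (- a); rewrite normrN => ? ?.
  have [xa|ax] := leP x a; [by left|right; rewrite leNgt; apply: contra xK => xb].
  by rewrite inE /= in_itv /=; apply/andP; split; lra.
have [] := @dominated_convergence _ _ _ mu setT measurableT
  (fun n x => (h x * box a b n x)%:E) (fun x => (h x * \1_(`]a, b[%classic) x)%:E) (EFin \o g).
- move=> n; apply/measurable_EFinP/measurable_funM => //.
  by apply: continuous_measurable_fun; apply: test_continuous; exact: test_box.
- by apply/measurable_EFinP/measurable_funM.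
- apply: aeW => x _; apply: cvg_EFin; first by near=> n.
  by apply: cvgMr; exact: box_cvg.
- exact: ig.
- apply: aeW => x n _; rewrite lee_fin fE normrM ler_piMr//; exact: box_norm.
move=> fi _ cv; have cst0 : (fun n => \int[mu]_x (h x * box a b n x)%:E)%E = (fun=> 0%E).
  apply/funext => n; have tb := test_box a b n.
  by rewrite (Rintegral_EFin measurableT (integrable_test lh tb)) (h0 _ tb).
rewrite cst0 in cv.
have z : \int[mu]_x (h x * \1_(`]a, b[%classic) x) = 0.
  by rewrite /Rintegral (cvg_unique (@ereal_hausdorff R) cv (cvg_cst _)).
rewrite Rintegral_mkcond -z; apply: eq_Rintegral => x _.
by rewrite patchE indicE; case: (x \in _); rewrite ?mulr1 ?mulr0.
Unshelve. all: by end_near. Qed.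

(** The fundamental lemma of the calculus of variations. All integrals over
    segments vanish, hence so does h, by Lebesgue differentiation. *)
Lemma test_orthogonal_ae h : locint h ->
  (forall phi, test_function phi -> \int[mu]_x (h x * phi x) = 0) ->
  {ae mu, forall x, h x = 0}.
Proof.
move=> lh h0.
have F0 (M y : R) : \int[mu]_(t in `[- M, y]) h t = 0.
  rewrite -Rintegral_itv_obnd_cbnd; last first.
    by apply: integrableS (@locint_segment _ _ (- M) y lh) => //; by apply: subset_itvr; rewrite bnd_simp.
  rewrite -Rintegral_itv_bndo_bndc; first exact: test_orthogonal_itv.
  by apply: integrableS (@locint_segment _ _ (- M) y lh) => //; exact: subset_itv_oo_cc.
have aeM (M : nat) : {ae mu, forall x, - M%:R < x -> h x = 0}.
  have := @FTC1 R h (BLeft (- M%:R)) (fun y => locint_segment _ _ lh) (locint_locally lh).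
  apply: ae_mono => x xF Mx; have [|_ <-] := xF; first by rewrite lte_fin.
  under eq_fun do rewrite F0.
  by rewrite derive1_cst.
have : {ae mu, forall x, forall M : nat, - M%:R < x -> h x = 0} by exact/ae_foralln.
apply: ae_mono => x /(_ (Num.bound x)); apply.
by rewrite ltrNl; exact: unstable.ltrNbound.
Qed.

Lemma not_ae_false (P : R -> Prop) : {ae mu, forall x, P x} -> exists x, P x.
Proof.
move=> [N [mN N0 PN]]; apply: contrapT => nP.
have NT : N = setT by rewrite -subTset => x _; apply: PN => Px; apply: nP; exists x.
have : (mu `[0%R, 1%R] <= mu N)%E by rewrite le_measure ?inE// NT.
by rewrite N0 lebesgue_measure_itv /= lte_fin ltr01 oppr0 adde0 lee_fin ler10.
Qed.

Lemma locint_cst (c : R) : locint (fun=> c).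
Proof. by apply: continuous_locint => x; exact: cvg_cst. Qed.

Lemma test_integrable phi : test_function phi -> mu.-integrable setT (EFin \o phi).
Proof.
move=> tphi; have := integrable_test (locint_cst 1) tphi.
by apply: eq_integrable => // x _ /=; rewrite mul1r.
Qed.

(** Were all test functions of integral 0, the fundamental lemma applied to the
    constant 1 would give 1 = 0. *)
Lemma test_unit_mass : exists phi, test_function phi /\ \int[mu]_x phi x = 1.
Proof.
have [] := pselect (exists phi, test_function phi /\ \int[mu]_x phi x != 0).
  move=> [phi [tphi phi0]]; exists (fun x => (\int[mu]_x phi x)^-1 * phi x).
  split; first exact: testZ.
  by rewrite RintegralZl ?mulVf//; exact: test_integrable.
move=> nphi; exfalso.
have [phi tphi|x /eqP] := not_ae_false (test_orthogonal_ae (locint_cst 1) _); last by rewrite oner_eq0.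
apply/eqP/negPn/negP => phi0; apply: nphi; exists phi; split => //.
by apply: contra phi0 => /eqP <-; apply/eqP/eq_Rintegral => x _; rewrite mul1r.
Qed.

(** The primitive from -oo is again compactly supported because its value to
    the right of the support is the total integral, 0. *)
Lemma test_primitive phi : test_function phi -> \int[mu]_x phi x = 0 ->
  exists psi, test_function psi /\ derive1 psi = phi.
Proof.
move=> /[dup] tphi /test_functionP[sphi [M [M0 phiM]]] phi0.
have iphi := test_integrable tphi.
pose psi x := \int[mu]_(t in `]-oo, x]) phi t.
have dpsi x : derivable psi x 1 /\ derive1 psi x = phi x.
  apply: (@continuous_FTC1 R phi -oo%O x (x + 1)) => //.
  - by rewrite ltrDl.
  - exact: integrableS iphi.
  - by rewrite ltNyr.
  - exact: (@test_continuous _ _ tphi x).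
have psiE : derive1 psi = phi by apply/funext => x; have [] := dpsi x.
exists psi; split; last exact: psiE.
apply/test_functionP; split.
  case=> [|n] x; first by have [] := dpsi x.
  by rewrite derive1Sn psiE; exact: sphi.
exists M; split=> // x; rewrite ler_normr => /orP[Mx|Mx].
  rewrite /psi Rintegral_mkcond -[RHS]phi0; apply: eq_Rintegral => t _.
  rewrite patchE; case: ifPn => //; rewrite notin_setE /= in_itv /= => /negP.
  rewrite -ltNge => xt; rewrite phiM// ler_normr (le_trans Mx (ltW xt))//.
have phi_left : {in `]-oo, x]%classic, phi =1 cst 0}.
  move=> t; rewrite inE /= in_itv /= => tx; rewrite phiM// ler_normr; apply/orP; right.
  by rewrite (le_trans Mx)// lerN2.
transitivity (\int[mu]_(t in `]-oo, x]) (0 : R)); first exact: eq_Rintegral.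
by rewrite Rintegral_cst// mul0r.
Qed.

(** Any test function is a multiple of a fixed one of integral 1 plus the
    derivative of a test function, so h and the constant c integrate it
    identically. *)
Lemma du_Bois_Reymond h : locint h ->
  (forall phi, test_function phi -> \int[mu]_x (h x * derive1 phi x) = 0) ->
  exists c, {ae mu, forall x, h x = c}.
Proof.
move=> lh h0; have [phi0 [tphi0 phi01]] := test_unit_mass.
pose c := \int[mu]_x (h x * phi0 x); exists c.
suff : {ae mu, forall x, h x + - c = 0}.
  by apply: ae_mono => x /eqP; rewrite subr_eq0 => /eqP.
have lhc := locintD lh (locint_cst (- c)).
apply: test_orthogonal_ae => // phi tphi.
pose m := \int[mu]_x phi x.
have tchi : test_function (fun x => phi x + (- m) * phi0 x).
  by apply: testD => //; exact: testZ.
have [|psi [tpsi psiE]] := test_primitive tchi.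
  rewrite RintegralD//; [|exact: test_integrable|exact/test_integrable/testZ].
  by rewrite RintegralZl ?phi01 ?mulr1 ?subrr//; exact: test_integrable.
have := h0 _ tpsi; rewrite psiE => hpsi.
have i1 := integrable_test lh tphi; have i2 := integrable_test lh tphi0.
have E : \int[mu]_x (h x * (phi x + (- m) * phi0 x)) = \int[mu]_x (h x * phi x) + (- m) * c.
  under eq_Rintegral do rewrite mulrDr mulrCA.
  rewrite RintegralD//; last exact: integrableZl i2.
  by rewrite RintegralZl.
rewrite -[RHS]hpsi E.
under eq_Rintegral do rewrite mulrDl.
rewrite RintegralD//; last exact: (integrable_test (locint_cst (- c))).
by congr (_ + _); rewrite RintegralZl ?mulNr 1?mulrC//; exact: test_integrable.
Qed.

End FundamentalLemma.

(** * Square-integrable functions and first-order weak derivatives *)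

Section WeakDerivative.
Variable R : realType.
Implicit Types f g h u v phi psi : R -> R.
Notation mu := (@lebesgue_measure R).

Definition L2 u := measurable_fun setT u /\
  mu.-integrable setT (EFin \o (fun x => u x ^+ 2)).

Definition wderiv u v := forall phi, test_function phi ->
  \int[mu]_x (u x * derive1 phi x) = - \int[mu]_x (v x * phi x).

Lemma L2_le u v : measurable_fun setT u -> (forall x, `|u x| <= `|v x|) ->
  L2 v -> L2 u.
Proof.
move=> mu_ uv [mv iv]; split => //; apply: le_integrable iv => //.
  by apply/measurable_EFinP; exact: measurable_funX.
move=> x _; rewrite /= lee_fin !normrX; exact: lerXn2r.
Qed.

Lemma L2M f u (B : R) : measurable_fun setT f -> (forall x, `|f x| <= B) ->
  L2 u -> L2 (fun x => f x * u x).
Proof.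
move=> mf fB [mu_ iu]; split; first exact: measurable_funM.
have := integrableZl measurableT (B ^+ 2) iu; apply: le_integrable => //.
  by apply/measurable_EFinP/measurable_funX/measurable_funM.
move=> x _; rewrite /= lee_fin exprMn [leLHS]normrM [leRHS]normrM ler_wpM2r// !normrX lerXn2r ?nnegrE//.
exact: le_trans (ler_norm B).
Qed.

Lemma L2Z (c : R) u : L2 u -> L2 (fun x => c * u x).
Proof. exact: (@L2M (fun=> c) u `|c|). Qed.

Lemma L2D u v : L2 u -> L2 v -> L2 (fun x => u x + v x).
Proof.
move=> [mu_ iu] [mv iv]; split; first exact: measurable_funD.
have i2 := integrableD measurableT (integrableZl measurableT 2 iu) (integrableZl measurableT 2 iv).
apply: le_integrable i2 => //.
  by apply/measurable_EFinP/measurable_funX/measurable_funD.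
move=> x _; rewrite /= lee_fin [leLHS]ger0_norm ?sqr_ge0// (le_trans _ (ler_norm _))//.
by have := sqr_ge0 (u x - v x); nra.
Qed.

Lemma L2_locint u : L2 u -> locint u.
Proof.
move=> [mu_ iu]; split => // M.
have iM : mu.-integrable `[- M, M] (EFin \o (fun x => u x ^+ 2)).
  exact: integrableS iu.
have i1 : mu.-integrable `[- M, M] (EFin \o (fun x => 1 + u x ^+ 2)).
  by have := integrableD _ ((locint_cst (1 : R)).2 M) iM; apply.
apply: le_integrable i1 => //.
  by apply/measurable_EFinP; exact: measurable_funTS.
move=> x _; rewrite /= lee_fin (le_trans _ (ler_norm _))//.
rewrite -real_normK ?num_real//; have := sqr_ge0 (`|u x| - 1); nra.
Qed.

Lemma L2_not_bounded_below v (D : set R) (d : R) : measurable D -> mu D = +oo%E ->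
  0 < d -> {ae mu, forall x, D x -> d <= `|v x|} -> ~ L2 v.
Proof.
move=> mD Doo d0 dv [mv iv].
have : (\int[mu]_(x in D) (d ^+ 2)%:E <= \int[mu]_x (v x ^+ 2)%:E)%E.
  apply: (@le_trans _ _ (\int[mu]_(x in D) (v x ^+ 2)%:E)%E).
    apply: ae_ge0_le_integral => //.
    - by move=> x _; rewrite lee_fin sqr_ge0.
    - by move=> x _; rewrite lee_fin sqr_ge0.
    - by apply/measurable_EFinP/measurable_funTS; exact: measurable_funX.
    - apply: ae_mono dv => x dv Dx; rewrite lee_fin -[leRHS]real_normK ?num_real//.
      by rewrite lerXn2r ?nnegrE ?dv// ltW.
  apply: ge0_subset_integral => //.
    by apply/measurable_EFinP; exact: measurable_funX.
  by move=> x _; rewrite lee_fin sqr_ge0.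
rewrite integral_cst//= Doo gt0_muley ?lte_fin ?exprn_gt0//.
by rewrite leye_eq => /eqP; have := integrable_lty measurableT iv => /[swap] ->.
Qed.

Lemma Rintegral_ae u v : measurable_fun setT u -> measurable_fun setT v ->
  {ae mu, forall x, u x = v x} -> \int[mu]_x u x = \int[mu]_x v x.
Proof.
move=> mu_ mv uv; congr fine; apply: ae_eq_integral => //.
- exact/measurable_EFinP.
- exact/measurable_EFinP.
- by apply: ae_mono uv => x -> _.
Qed.

Lemma wderiv_ae u u' v v' : locint u -> locint u' -> locint v -> locint v' ->
  {ae mu, forall x, u x = u' x} -> {ae mu, forall x, v x = v' x} ->
  wderiv u v -> wderiv u' v'.
Proof.
move=> [mu1 _] [mu2 _] [mv1 _] [mv2 _] uu vv uv phi tphi.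
have tphi' := test_derive1 tphi.
have mphi f : test_function f -> measurable_fun setT f.
  by move=> tf; apply: continuous_measurable_fun; exact: test_continuous.
have E1 : \int[mu]_x (u x * derive1 phi x) = \int[mu]_x (u' x * derive1 phi x).
  apply: Rintegral_ae; [by apply: measurable_funM => //; exact: mphi tphi'..|].
  by apply: ae_mono uu => x ->.
have E2 : \int[mu]_x (v x * phi x) = \int[mu]_x (v' x * phi x).
  apply: Rintegral_ae; [by apply: measurable_funM => //; exact: mphi..|].
  by apply: ae_mono vv => x ->.
by rewrite -E1 -E2; exact: uv.
Qed.

Lemma derive1_mul f phi : smooth f -> smooth phi -> forall x,
  derive1 (fun x => f x * phi x) x = f x * derive1 phi x + phi x * derive1 f x.
Proof.
move=> sf sphi x; rewrite derive1E; apply: derive_val.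
have d1 := smooth_is_derive x sf; have d2 := smooth_is_derive x sphi.
exact: (@is_deriveM _ _ _ _ _ _ _ _ d1 d2).
Qed.

(** Leibniz rule with a smooth factor f: move f onto the test function. *)
Lemma wderivM f u v : smooth f -> locint u -> locint v -> wderiv u v ->
  wderiv (fun x => f x * u x) (fun x => derive1 f x * u x + f x * v x).
Proof.
move=> sf lu lv uv phi tphi.
have tf := test_mul sf tphi; have [sphi _] := (test_functionP phi).1 tphi.
have tf' : test_function (fun x => derive1 f x * phi x).
  exact: (test_mul (smooth_derive1 sf) tphi).
have i1 := integrable_test lu (test_derive1 tf).
have i2 := integrable_test lu tf'.
have i3 := integrable_test lv tf.
have -> : \int[mu]_x (f x * u x * derive1 phi x) =
    \int[mu]_x (u x * derive1 (fun x => f x * phi x) x) -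
    \int[mu]_x (u x * (derive1 f x * phi x)).
  rewrite -RintegralB//; apply: eq_Rintegral => x _.
  by rewrite derive1_mul//; ring.
rewrite (uv _ tf).
have -> : \int[mu]_x ((derive1 f x * u x + f x * v x) * phi x) =
    \int[mu]_x (u x * (derive1 f x * phi x)) + \int[mu]_x (v x * (f x * phi x)).
  by rewrite -RintegralD//; apply: eq_Rintegral => x _; ring.
by rewrite opprD addrC.
Qed.

Lemma wderivD u v u' v' : locint u -> locint v -> locint u' -> locint v' ->
  wderiv u u' -> wderiv v v' -> wderiv (fun x => u x + v x) (fun x => u' x + v' x).
Proof.
move=> lu lv lu' lv' uu vv phi tphi; have tphi' := test_derive1 tphi.
under eq_Rintegral do rewrite mulrDl.
rewrite RintegralD//; [|exact: integrable_test..].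
under [in RHS]eq_Rintegral do rewrite mulrDl.
rewrite [in RHS]RintegralD//; [|exact: integrable_test..].
by rewrite (uu _ tphi) (vv _ tphi) opprD.
Qed.

Lemma wderivZ (c : R) u v : locint u -> locint v -> wderiv u v ->
  wderiv (fun x => c * u x) (fun x => c * v x).
Proof.
move=> lu lv uv phi tphi; have tphi' := test_derive1 tphi.
under eq_Rintegral do rewrite -mulrA.
rewrite RintegralZl//; last exact: integrable_test.
under [in RHS]eq_Rintegral do rewrite -mulrA.
by rewrite [in RHS]RintegralZl ?mulrN ?(uv _ tphi) ?mulrN//; exact: integrable_test.
Qed.

(** Uniqueness for first-order equations, whatever the coefficient: exp(-a x) v
    has zero weak derivative, hence is a constant c, and c exp(a x) is at
    least |c| in absolute value on a half-line, which forces c = 0 in L2. *)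
Lemma L2_wderiv_exp (a : R) v : L2 v -> wderiv v (fun x => a * v x) ->
  {ae mu, forall x, v x = 0}.
Proof.
move=> L2v vv; have lv := L2_locint L2v.
have se := @smooth_expRM R (- a).
have ce := smooth_continuous se.
have vh := wderivM se lv (L2_locint (L2Z a L2v)) vv.
have lh : locint (fun x => expR (- a * x) * v x).
  by have := locintM lv ce; congr locint; apply/funext => x; rewrite mulrC.
have [|c hc] := @du_Bois_Reymond R (fun x => expR (- a * x) * v x) lh.
  move=> phi tphi; rewrite (vh _ tphi) -[RHS]oppr0; congr (- _).
  rewrite -[RHS](mul0r (fine (mu setT))) -(@Rintegral_cst _ _ _ mu)//.
  by apply: eq_Rintegral => x _; rewrite derive1_expRM; ring.
have vE : {ae mu, forall x, v x = c * expR (a * x)}.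
  apply: ae_mono hc => x <-; rewrite mulrAC -expRD mulNr addNr expR0 mul1r//.
have [c0|c0] := eqVneq c 0.
  by apply: ae_mono vE => x ->; rewrite c0 mul0r.
exfalso; have c1 : 0 < `|c| by rewrite normr_gt0.
have [a0|a0] := leP 0 a.
  apply: (@L2_not_bounded_below v `[0, +oo[%classic `|c| _ _ c1 _ L2v) => //.
    by rewrite lebesgue_measure_itv /= ltry.
  apply: ae_mono vE => x -> /=; rewrite in_itv /= andbT => x0.
  rewrite normrM [`|expR _|]ger0_norm ?expR_ge0// ler_peMr// -expR0 ler_expR.
  exact: mulr_ge0.
apply: (@L2_not_bounded_below v `]-oo, 0]%classic `|c| _ _ c1 _ L2v) => //.
  by rewrite lebesgue_measure_itv /= ltNyr.
apply: ae_mono vE => x -> /=; rewrite in_itv /= => x0.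
rewrite normrM [`|expR _|]ger0_norm ?expR_ge0// ler_peMr// -expR0 ler_expR.
by rewrite mulr_le0// ltW.
Qed.

End WeakDerivative.

(** * Integral kernels *)

Section Kernel.
Variable R : realType.
Implicit Types f g h u v w phi psi : R -> R.
Notation mu := (@lebesgue_measure R).
Notation RR := (measurableTypeR R * measurableTypeR R)%type.

Lemma measurable_Rintegral_ge0 (F : R -> R -> R) :
  measurable_fun [set: RR] (fun z => F z.1 z.2) -> (forall x t, 0 <= F x t) ->
  measurable_fun setT (fun x => \int[mu]_t F x t).
Proof.
move=> mF F0.
apply: (@measurableT_comp _ _ _ _ _ _ fine _ (fun x => \int[mu]_t (F x t)%:E)%E).
  exact: fine_measurable.
apply: (@measurable_fun_fubini_tonelli_F _ _ (measurableTypeR R) (measurableTypeR R) R mu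
  (fun z => (F z.1 z.2)%:E)).
  exact/measurable_EFinP.
by move=> z; rewrite lee_fin.
Qed.

Lemma measurable_section1 (F : R -> R -> R) x :
  measurable_fun [set: RR] (fun z => F z.1 z.2) -> measurable_fun setT (F x).
Proof. by move=> mF; have := @measurable_fun_pair2 _ _ _ _ _ _ _ x mF. Qed.

Lemma measurable_section2 (F : R -> R -> R) t :
  measurable_fun [set: RR] (fun z => F z.1 z.2) -> measurable_fun setT (F ^~ t).
Proof. by move=> mF; have := @measurable_fun_pair1 _ _ _ _ _ _ _ t mF. Qed.

(** When is u(x) = int K(x, t) g(t) dt a weak solution of u' = a u + g? *)
Section KernelSolution.
Variables (K : R -> R -> R) (g : R -> R) (a : R).
Hypothesis mK : measurable_fun [set: RR] (fun z => K z.1 z.2).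
Hypothesis lg : locint g.
Hypothesis Kg : forall x, mu.-integrable setT (EFin \o (fun t => K x t * g t)).
Let u x := \int[mu]_t (K x t * g t).
Let w x := \int[mu]_t `|K x t * g t|.
Hypothesis lw : locint w.
Hypothesis lK : forall t, locint (K ^~ t).
Hypothesis Ktest : forall phi t, test_function phi ->
  \int[mu]_x (K x t * (derive1 phi x + a * phi x)) = - phi t.

Lemma measurable_kernel_mul : measurable_fun [set: RR] (fun z => K z.1 z.2 * g z.2).
Proof.
apply: measurable_funM => //.
by apply: measurableT_comp => //; have [] := lg.
Qed.

Lemma kernel_le x : `|u x| <= w x.
Proof. exact: le_normr_Rintegral. Qed.

(** The integrand is split as a difference of two nonnegative functions, to which
    Tonelli's theorem applies. *)
Lemma kernel_measurable : measurable_fun setT u.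
Proof.
have uE x : u x = w x - \int[mu]_t (`|K x t * g t| - K x t * g t).
  have iN := integrable_norm (Kg x).
  by rewrite /w RintegralB// subKr.
rewrite (_ : u = (fun x => w x - \int[mu]_t (`|K x t * g t| - K x t * g t))); last exact/funext.
have mKg := measurable_kernel_mul.
apply: measurable_funB; first by have [] := lw.
apply: (@measurable_Rintegral_ge0 (fun x t => `|K x t * g t| - K x t * g t)).
  by apply: measurable_funB => //; exact: measurableT_comp.
by move=> x t; rewrite subr_ge0 ler_norm.
Qed.

Lemma kernel_locint : locint u.
Proof.
have [_ iw] := lw; split=> [|M]; first exact: kernel_measurable.
apply: le_integrable (iw M) => //.
  by apply/measurable_EFinP/measurable_funTS; exact: kernel_measurable.
by move=> x _; rewrite /= lee_fin (le_trans (kernel_le x))// ler_norm.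
Qed.

(** Fubini: the transposed kernel inverts phi' + a phi, the adjoint operator up to
    sign, on test functions (Ktest), so the kernel inverts u' - a u weakly. *)
Lemma kernel_wderiv : wderiv u (fun x => a * u x + g x).
Proof.
move=> phi tphi.
pose xi x := derive1 phi x + a * phi x.
have txi : test_function xi by apply: testD; [exact: test_derive1|exact: testZ].
have mxi : measurable_fun setT xi.
  by apply: continuous_measurable_fun; exact: test_continuous.
pose F (z : RR) := ((K z.1 z.2 * g z.2 * xi z.1)%:E).
have mF : measurable_fun setT F.
  apply/measurable_EFinP; apply: measurable_funM; first exact: measurable_kernel_mul.
  exact: measurableT_comp.
have iF : (mu \x mu)%E.-integrable setT F.
  apply/integrable12ltyP => //.
  have := integrable_test lw txi => /integrableP[_].
  apply: le_lt_trans; rewrite le_eqVlt; apply/orP; left; apply/eqP.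
  apply: eq_integral => x _; rewrite /F /=.
  have iN := integrable_norm (Kg x).
  under eq_integral do rewrite normrM EFinM.
  rewrite integralZr//; first by rewrite Rintegral_EFin// -EFinM normrM [`|w x|]ger0_norm//; apply: Rintegral_ge0.
have fub := @Fubini _ _ _ _ R mu mu F iF.
have L : (\int[mu]_x \int[mu]_t F (x, t))%E = (\int[mu]_x (u x * xi x)%:E)%E.
  apply: eq_integral => x _; rewrite /F /=.
  under eq_integral => t _ do rewrite (EFinM (K x t * g t)).
  by rewrite (integralZr measurableT (Kg x)) (Rintegral_EFin measurableT (Kg x)) -EFinM.
have Q : (\int[mu]_t \int[mu]_x F (x, t))%E = (\int[mu]_t (-1 * (g t * phi t))%:E)%E.
  apply: eq_integral => t _; rewrite /F /=.
  have iK := integrable_test (lK t) txi.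
  under eq_integral do rewrite mulrAC mulrC EFinM.
  rewrite (integralZl measurableT iK) (Rintegral_EFin measurableT iK) -EFinM.
  by rewrite (Ktest t tphi) mulrN mulN1r.
have lu := kernel_locint.
have {fub L Q} : \int[mu]_x (u x * xi x) = - \int[mu]_x (g x * phi x).
  rewrite -mulN1r -(RintegralZl _ measurableT (integrable_test lg tphi)).
  by rewrite /Rintegral -Q -fub L.
rewrite /xi => E.
have i1 := integrable_test lu (test_derive1 tphi).
have i2 := integrable_test lu tphi.
have i3 := integrable_test lg tphi.
have E1 : \int[mu]_x (u x * (derive1 phi x + a * phi x)) =
    \int[mu]_x (u x * derive1 phi x) + a * \int[mu]_x (u x * phi x).
  under eq_Rintegral do rewrite mulrDr mulrCA.
  by rewrite RintegralD//; [rewrite RintegralZl|exact: (integrableZl _ _ i2)].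
have E2 : \int[mu]_x ((a * u x + g x) * phi x) =
    a * \int[mu]_x (u x * phi x) + \int[mu]_x (g x * phi x).
  under eq_Rintegral do rewrite mulrDl -mulrA.
  by rewrite RintegralD//; [rewrite RintegralZl|exact: (integrableZl _ _ i2)].
by rewrite E2 opprD -E E1 addrC addrK.
Qed.

End KernelSolution.
End Kernel.

(** * Solving first-order equations in L2 *)

Section Green.
Variable R : realType.
Implicit Types f g h u v w phi psi : R -> R.
Notation mu := (@lebesgue_measure R).
Notation RR := (measurableTypeR R * measurableTypeR R)%type.

(** The two fundamental solutions of d/dx: the step supported on t <= x and,
    shifted by the constant -1, the one supported on x < t. *)
Definition jump (b : bool) (x t : R) : R :=
  if t <= x then (if b then 1 else 0) else (if b then 0 else -1).

(** Fundamental solutions of d/dx - a. The one decaying at infinity is chosen by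
    b: it is supported on t <= x when a < 0 and on x < t when a > 0. *)
Definition green (b : bool) (a : R) (x t : R) : R := jump b x t * expR (a * (x - t)).

Lemma jump_norm b x t : `|jump b x t| <= 1.
Proof. by rewrite /jump; case: ifP; case: b; rewrite ?normr1 ?normr0 ?normrN1. Qed.

Lemma jumpE x t : jump true x t - jump false x t = 1.
Proof. by rewrite /jump; case: ifP; rewrite ?subr0 ?sub0r ?opprK. Qed.

Lemma measurable_jump b : measurable_fun [set: RR] (fun z => jump b z.1 z.2).
Proof.
apply: measurable_fun_ifT => //; exact: measurable_fun_ler.
Qed.

Lemma measurable_green b a : measurable_fun [set: RR] (fun z => green b a z.1 z.2).
Proof.
apply: measurable_funM; first exact: measurable_jump.
apply: measurableT_comp => //; apply: measurable_funM => //.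
exact: measurable_funB.
Qed.

Lemma jump_true_test t psi : test_function psi ->
  \int[mu]_x (jump true x t * derive1 psi x) = - psi t.
Proof.
move=> tpsi; have tpsi' := test_derive1 tpsi.
have [spsi [M [M0 psiM]]] := (test_functionP psi).1 tpsi.
have [_ [N [N0 psiN]]] := (test_functionP _).1 tpsi'.
pose K := Num.max (Num.max M N) (t + 1).
have MK : M <= K by rewrite !le_max lexx.
have NK : N <= K by rewrite !le_max lexx orbT.
have tK : t + 1 <= K by rewrite le_max lexx orbT.
have tK' : t < K by rewrite (lt_le_trans _ tK)// ltrDl.
have K0 : 0 <= K by rewrite (le_trans _ MK)// ltW.
have c' : continuous (derive1 psi) by exact: test_continuous.
have cpsi : continuous psi by exact: test_continuous.
have FTC : (\int[mu]_(x in `[t, K]) (derive1 psi x)%:E = (psi K)%:E - (psi t)%:E)%E.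
  apply: continuous_FTC2 => //.
    exact: continuous_subspaceT.
  split.
  - by move=> x _; exact: smooth_derivable.
  - by apply: cvg_at_right_filter; exact: cpsi.
  - by apply: cvg_at_left_filter; exact: cpsi.
transitivity (\int[mu]_(x in `[t, K]) derive1 psi x).
  rewrite [RHS]Rintegral_mkcond; apply: eq_Rintegral => x _.
  rewrite patchE /jump mem_setE in_itv /=.
  case: (boolP (t <= x)) => tx /=; last by rewrite mul0r.
  rewrite mul1r; case: (boolP (x <= K)) => //=; rewrite -ltNge => Kx.
  by rewrite psiN// (le_trans NK)// (le_trans (ltW Kx))// ler_norm.
by rewrite /Rintegral FTC psiM /= ?sub0r// ger0_norm.
Qed.

Lemma jump_test b t psi : test_function psi ->
  \int[mu]_x (jump b x t * derive1 psi x) = - psi t.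
Proof.
move=> tpsi; case: b; first exact: jump_true_test.
have tpsi' := test_derive1 tpsi.
have i0 := test_integrable tpsi'.
have [spsi [M [M0 psiM]]] := (test_functionP psi).1 tpsi.
have [_ [N [N0 psiN]]] := (test_functionP _).1 tpsi'.
have mjump b : measurable_fun setT (fun x => jump b x t).
  exact: (@measurable_section2 _ (jump b) t (measurable_jump b)).
have ib b : mu.-integrable setT (EFin \o (fun x => jump b x t * derive1 psi x)).
  apply: le_integrable i0 => //.
    apply/measurable_EFinP/measurable_funM; first exact: mjump.
    by apply: continuous_measurable_fun; exact: (test_continuous tpsi').
  move=> x _; rewrite /= lee_fin normrM ler_piMl//; exact: jump_norm.
have I0 : \int[mu]_x derive1 psi x = 0.
  have := jump_true_test (- Num.max M N) tpsi; rewrite psiM ?oppr0; last first.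
    by rewrite normrN (le_trans _ (ler_norm _))// le_max lexx.
  move=> <-; apply: eq_Rintegral => x _; rewrite /jump; case: ifPn; rewrite ?mul1r// -ltNge => xN.
  rewrite psiN ?mulr0// ler_normr lerNr; apply/orP; right.
  by rewrite (le_trans (ltW xN))// lerN2 le_max lexx orbT.
rewrite -(jump_true_test t tpsi) -[RHS]subr0 -I0 -RintegralB//.
apply: eq_Rintegral => x _.
by rewrite -[jump false x t](subKr (jump true x t)) jumpE mulrBl mul1r.
Qed.

Lemma locint_green b a t : locint (green b a ^~ t).
Proof.
have mg : measurable_fun setT (green b a ^~ t).
  exact: (measurable_section2 t (measurable_green b a)).
have ce : continuous (fun x : R => expR (a * x)) by exact/smooth_continuous/smooth_expRM.
have [_ ie] := locintM (continuous_locint ce) (@cst_continuous _ _ (expR (- a * t))).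
split => // M; apply: le_integrable (ie M) => //.
  by apply/measurable_EFinP; exact: measurable_funTS.
move=> x _; rewrite /= lee_fin /green -expRD mulrBr -mulNr normrM ler_piMl//.
exact: jump_norm.
Qed.

(** With psi = exp(a x) phi, the left-hand side is exp(-a t) times the integral
    of a step against psi'. *)
Lemma green_test b a t phi : test_function phi ->
  \int[mu]_x (green b a x t * (derive1 phi x + a * phi x)) = - phi t.
Proof.
move=> tphi; have [sphi _] := (test_functionP phi).1 tphi.
have se := @smooth_expRM R a.
have tpsi := test_mul se tphi.
have i1 := jump_test b t tpsi.
have im : mu.-integrable setT (EFin \o (fun x => jump b x t * derive1 (fun x => expR (a * x) * phi x) x)).
  apply: le_integrable (test_integrable (test_derive1 tpsi)) => //.
    apply/measurable_EFinP/measurable_funM.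
      exact: (@measurable_section2 _ (jump b) t (measurable_jump b)).
    by apply: continuous_measurable_fun; exact: (test_continuous (test_derive1 tpsi)).
  move=> x _; rewrite /= lee_fin normrM ler_piMl//; exact: jump_norm.
transitivity (expR (- a * t) * \int[mu]_x (jump b x t * derive1 (fun x => expR (a * x) * phi x) x)).
  rewrite -RintegralZl//; apply: eq_Rintegral => x _.
  rewrite derive1_mul// derive1_expRM /green mulrBr expRD -mulNr; ring.
by rewrite i1 mulrN mulrA -expRD mulNr addNr expR0 mul1r.
Qed.

(** A symmetric majorant of both kernels, for m = |a|. *)
Definition expk (m x t : R) : R := expR (- (m * `|x - t|)).

Lemma integral_expR_ray (m x : R) : 0 < m ->
  (\int[mu]_(t in `[x, +oo[) (expR (- (m * (t - x))))%:E = (m^-1)%:E)%E.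
Proof.
move=> m0; have mn : m != 0 by rewrite gt_eqF.
pose F (t : R) := - m^-1 * expR (- m * t + m * x).
have sF : smooth F.
  apply: smoothM; first exact: smooth_cst.
  exact: (@smooth_affine _ expR (- m) (m * x) (@smooth_expR R)).
have F' t : derive1 F t = expR (- (m * (t - x))).
  have sE := @smooth_affine _ expR (- m) (m * x) (@smooth_expR R).
  rewrite /F (derive1_mul (@smooth_cst R (- m^-1)) sE) derive1_cst mulr0 addr0.
  rewrite derive1E.
  rewrite (@derive_val _ _ _ _ _ _ _ (@is_derive_affine _ expR (- m) (m * x) t _ (is_derive_expR _))).
  rewrite mulrA mulrNN mulVf// mul1r; congr expR; ring.
rewrite (@ge0_continuous_FTC2y _ _ F x 0).
- rewrite /F (_ : - m * x + m * x = 0) ?expR0 ?mulr1; last by ring.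
  by rewrite -EFinB sub0r opprK.
- by move=> t _; exact: expR_ge0.
- apply: continuous_subspaceT => t; apply: smooth_continuous.
  have := @smooth_affine _ expR (- m) (m * x) (@smooth_expR R); congr smooth.
  by apply/funext => y; congr expR; ring.
- have h : m * (t - x) @[t --> +oo] --> +oo.
    by apply: gt0_cvgMry => //; exact: cvg_addrr.
  have /= h0 := cvg_comp _ _ h (@cvgr_expR R).
  rewrite /F -(mulr0 (- m^-1)); apply: cvgMr.
  have -> : (fun t => expR (- m * t + m * x)) = (fun t => expR (- (m * (t - x)))).
    by apply/funext => y; congr expR; ring.
  exact: h0.
- by move=> t _; exact: smooth_derivable.
- by apply: cvg_at_right_filter; exact: (smooth_continuous sF).
- by move=> t _; rewrite F'.
Qed.

End Green.

Section FirstOrder.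
Variable R : realType.
Implicit Types f g h u v w phi psi : R -> R.
Notation mu := (@lebesgue_measure R).
Notation RR := (measurableTypeR R * measurableTypeR R)%type.

Lemma expkC (m x t : R) : expk m x t = expk m t x.
Proof. by rewrite /expk distrC. Qed.

Lemma expk_ge0 (m x t : R) : 0 <= expk m x t.
Proof. exact: expR_ge0. Qed.

Lemma expk_le1 (m x t : R) : 0 < m -> expk m x t <= 1.
Proof.
by move=> m0; rewrite /expk -expR0 ler_expR oppr_le0 mulr_ge0// ltW.
Qed.

Lemma measurable_expk m : measurable_fun [set: RR] (fun z => expk m z.1 z.2).
Proof.
apply: measurableT_comp => //; apply: measurableT_comp => //.
apply: measurable_funM => //; apply: measurableT_comp => //.
exact: measurable_funB.
Qed.

Lemma integral_expk (m x : R) : 0 < m ->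
  (\int[mu]_t (expk m x t)%:E = (2 * m^-1)%:E)%E.
Proof.
move=> m0.
have mk : measurable_fun setT (EFin \o expk m x).
  apply/measurable_EFinP; exact: (measurable_section1 x (measurable_expk m)).
have ray y : (\int[mu]_(t in `[y, +oo[) (expk m y t)%:E = (m^-1)%:E)%E.
  rewrite -(integral_expR_ray y m0); apply: eq_integral => t.
  by rewrite inE /= in_itv /= andbT => yt; rewrite /expk distrC ger0_norm// subr_ge0.
have E : setT = `]-oo, x[%classic `|` `[x, +oo[%classic.
  apply/esym/seteqP; split=> // t _ /=; rewrite !in_itv /= andbT.
  by case: (ltP t x); [left|right].
rewrite E ge0_integral_setU//=; last 3 first.
- by rewrite -E.
- by move=> t _; rewrite lee_fin expk_ge0.
- apply/disj_setPS => t /= []; rewrite !in_itv /= andbT => tx xt.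
  by move: (lt_le_trans tx xt); rewrite ltxx.
rewrite ray integral_itv_bndo_bndc; last exact: measurable_funTS.
have := @ge0_integration_by_substitutionNy R (expk m x) (- x).
rewrite opprK => ->; last 2 first.
- apply: continuous_subspaceT => t; rewrite /expk.
  apply: continuous_comp; last exact: continuous_expR.
  apply: cvgN; apply: cvgMr; apply: cvg_norm; apply: cvgB; [exact: cvg_cst|exact: cvg_id].
- by move=> t _; exact: expk_ge0.
rewrite (_ : (\int[mu]_(t in _) _)%E = (m^-1)%:E); first by rewrite -EFinD mulr_natl mulr2n.
rewrite -(ray (- x)); apply: eq_integral => t _ /=.
by rewrite /expk /= opprK -[in RHS]normrN opprB opprK addrC.
Qed.

Lemma integrable_expk (m x : R) : 0 < m -> mu.-integrable setT (EFin \o expk m x).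
Proof.
move=> m0; apply/integrableP; split.
  apply/measurable_EFinP; exact: (measurable_section1 x (measurable_expk m)).
under eq_integral do rewrite /= ger0_norm ?expk_ge0//.
by rewrite integral_expk// ltry.
Qed.

Lemma Rintegral_expk (m x : R) : 0 < m -> \int[mu]_t expk m x t = 2 * m^-1.
Proof. by move=> m0; rewrite /Rintegral integral_expk. Qed.

Section Schur.
Variables (m : R) (g : R -> R).
Hypothesis m0 : 0 < m.
Hypothesis L2g : L2 g.
Let mg : measurable_fun setT g. Proof. by have [] := L2g. Qed.
Let ig2 : mu.-integrable setT (EFin \o (fun t => g t ^+ 2)).
Proof. by have [] := L2g. Qed.
Let mk x : measurable_fun setT (expk m x).
Proof. exact: (measurable_section1 x (measurable_expk m)). Qed.

Lemma integrable_expk_sqr x : mu.-integrable setT (EFin \o (fun t => expk m x t * g t ^+ 2)).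
Proof.
apply: le_integrable ig2 => //.
  by apply/measurable_EFinP; apply: measurable_funM; [exact: mk|exact: measurable_funX].
by move=> t _; rewrite /= lee_fin normrM ler_piMl// ger0_norm ?expk_ge0// expk_le1.
Qed.

Lemma integrable_expk_norm x : mu.-integrable setT (EFin \o (fun t => expk m x t * `|g t|)).
Proof.
have i2 := integrableD measurableT (integrable_expk x m0) (integrable_expk_sqr x).
apply: le_integrable i2 => //.
  by apply/measurable_EFinP; apply: measurable_funM; [exact: mk|exact: measurableT_comp].
move=> t _; rewrite /= lee_fin (le_trans _ (ler_norm _))// ger0_norm ?mulr_ge0 ?expk_ge0//.
rewrite -[X in _ <= X + _]mulr1 -mulrDr ler_wpM2l ?expk_ge0//.
rewrite -[g t ^+ 2]real_normK ?num_real//; have := sqr_ge0 (`|g t| - 1); nra.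
Qed.

(** Cauchy-Schwarz for the weight k, obtained by integrating
    2 c |g| <= c^2 + g^2 and choosing the constant c. *)
Lemma schur_pointwise x :
  (\int[mu]_t (expk m x t * `|g t|)) ^+ 2 <=
  2 * m^-1 * \int[mu]_t (expk m x t * g t ^+ 2).
Proof.
set W := \int[mu]_t _; set Q := (X in _ <= _ * X); pose C := 2 * m^-1.
have C0 : 0 < C by rewrite mulr_gt0// invr_gt0.
have iN := integrable_expk_norm x; have iQ := integrable_expk_sqr x.
have ik := integrable_expk x m0.
(* the value of c that minimises c^2 C - 2 c W *)
pose c := W / C.
have key : 2 * c * W <= c ^+ 2 * C + Q.
  rewrite /W /C -(Rintegral_expk x m0) /Q -!RintegralZl// -RintegralD//; last exact: (integrableZl _ _ ik).
  apply: le_Rintegral => //; first exact: (integrableZl _ _ iN).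
    have := integrableD measurableT (integrableZl measurableT (c ^+ 2) ik) iQ; exact.
  move=> t _; have := expk_ge0 m x t; have := sqr_ge0 (c - `|g t|).
  rewrite -[g t ^+ 2]real_normK ?num_real//; nra.
have WC : W = c * C by rewrite /c divfK// gt_eqF.
rewrite -/C; move: key; rewrite WC; nra.
Qed.

(** Schur's test: the kernel has integral 2/m in each variable, so integrating
    the pointwise bound with Tonelli's theorem bounds the L2 norm. *)
Lemma schur_L2 : L2 (fun x => \int[mu]_t (expk m x t * `|g t|)).
Proof.
have mN : measurable_fun [set: RR] (fun z => expk m z.1 z.2 * `|g z.2|).
  apply: measurable_funM; first exact: measurable_expk.
  by apply: measurableT_comp => //; exact: measurableT_comp.
have mQ : measurable_fun [set: RR] (fun z => expk m z.1 z.2 * g z.2 ^+ 2).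
  apply: measurable_funM; first exact: measurable_expk.
  by apply: measurable_funX; exact: measurableT_comp.
have k0 := expk_ge0 m.
have mW : measurable_fun setT (fun x => \int[mu]_t (expk m x t * `|g t|)).
  by apply: (@measurable_Rintegral_ge0 R (fun x t => expk m x t * `|g t|)) => // x t; rewrite mulr_ge0.
split => //.
have mQ' : measurable_fun setT (fun x => \int[mu]_t (expk m x t * g t ^+ 2)).
  by apply: (@measurable_Rintegral_ge0 R (fun x t => expk m x t * g t ^+ 2)) => // x t; rewrite mulr_ge0 ?sqr_ge0.
have iQ : mu.-integrable setT (EFin \o (fun x => \int[mu]_t (expk m x t * g t ^+ 2))).
  apply/integrableP; split; first exact/measurable_EFinP.
  have -> : (\int[mu]_x `|(EFin \o (fun x => \int[mu]_t (expk m x t * g t ^+ 2))%R) x| =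
     \int[mu]_x \int[mu]_t (expk m x t * g t ^+ 2)%:E)%E.
    apply: eq_integral => x _; rewrite Rintegral_EFin//; last exact: integrable_expk_sqr.
    rewrite /= ger0_norm//; apply: Rintegral_ge0 => t _; by rewrite mulr_ge0 ?sqr_ge0.
  have := @fubini_tonelli _ _ _ _ R mu mu (fun z : RR => (expk m z.1 z.2 * g z.2 ^+ 2)%:E).
  move=> -> /=; [|exact/measurable_EFinP|by move=> z; rewrite lee_fin mulr_ge0 ?sqr_ge0].
  have -> : (\int[mu]_t \int[mu]_x (expk m x t * g t ^+ 2)%:E =
     \int[mu]_t ((2 * m^-1)%:E * (g t ^+ 2)%:E))%E.
    apply: eq_integral => t _.
    under eq_integral do rewrite expkC EFinM.
    by rewrite (integralZr _ (integrable_expk t m0))// integral_expk.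
  rewrite integralZl//; have := integrable_fin_num measurableT ig2.
  by move=> /fineK <-; rewrite -EFinM ltry.
have := integrableZl measurableT (2 * m^-1) iQ; apply: le_integrable => //.
  by apply/measurable_EFinP; exact: measurable_funX.
move=> x _; rewrite /= lee_fin ger0_norm ?sqr_ge0// (le_trans _ (ler_norm _))//.
exact: schur_pointwise.
Qed.

End Schur.

(** Existence in L2 needs a nonzero coefficient, so that one of the fundamental
    solutions decays exponentially. *)
Lemma first_order_real (a : R) g : a != 0 -> L2 g ->
  exists u, L2 u /\ wderiv u (fun x => a * u x + g x).
Proof.
move=> a0 L2g; have m0 : 0 < `|a| by rewrite normr_gt0.
pose b := a < 0; have [mg _] := L2g.
have Kk x t : `|green b a x t| <= expk `|a| x t.
  rewrite /green normrM [`|expR _|]ger0_norm ?expR_ge0// /expk /jump /b.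
  case: (ltP a 0) => sa; case: (leP t x) => xt; rewrite ?normr1 ?normr0 ?normrN1 ?mul0r ?mul1r ?expR_ge0// ler_expR.
    by rewrite (ltr0_norm sa) mulNr opprK ger0_norm// subr_ge0.
  by rewrite (ger0_norm sa) ltr0_norm ?subr_lt0// mulrN opprK.
have mK := measurable_green b a.
have mKx x : measurable_fun setT (green b a x) by exact: (measurable_section1 x mK).
have Kg x : mu.-integrable setT (EFin \o (fun t => green b a x t * g t)).
  apply: le_integrable (integrable_expk_norm m0 L2g x) => //.
    by apply/measurable_EFinP; apply: measurable_funM => //; exact: mKx.
  move=> t _; rewrite /= lee_fin [leLHS]normrM [leRHS]normrM normr_id ler_wpM2r//.
  by rewrite (le_trans (Kk x t))// ler_norm.
have L2w : L2 (fun x => \int[mu]_t `|green b a x t * g t|).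
  apply: L2_le (schur_L2 m0 L2g).
    apply: (@measurable_Rintegral_ge0 R (fun x t => `|green b a x t * g t|)) => //.
    apply: measurableT_comp => //; apply: measurable_funM => //.
    exact: measurableT_comp.
  move=> x; rewrite ger0_norm; last exact: Rintegral_ge0.
  rewrite (le_trans _ (ler_norm _))//; apply: le_Rintegral => //.
  - exact: integrable_norm (Kg x).
  - exact: integrable_expk_norm.
  - by move=> t _; rewrite normrM ler_wpM2r.
have lg := L2_locint L2g; have lw := L2_locint L2w.
have lK := locint_green b a.
exists (fun x => \int[mu]_t (green b a x t * g t)); split.
  apply: L2_le L2w; first exact: kernel_measurable.
  by move=> x; rewrite [leRHS]ger0_norm ?kernel_le//; exact: Rintegral_ge0.
apply: kernel_wderiv => // phi t tphi; exact: green_test.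
Qed.

End FirstOrder.

(** * Primitives and the zero-mean condition *)

Section Primitive.
Variable R : realType.
Implicit Types f g h u v w phi psi : R -> R.
Notation mu := (@lebesgue_measure R).
Notation RR := (measurableTypeR R * measurableTypeR R)%type.

(** |f| <= |x f| outside [-1, 1], and f is integrable on [-1, 1]. *)
Lemma integrable_weight f : locint f ->
  mu.-integrable setT (EFin \o (fun x => x * f x)) -> mu.-integrable setT (EFin \o f).
Proof.
move=> [mf lf] iw.
have i1 : mu.-integrable setT (EFin \o (f \_ `[- 1, 1])).
  by rewrite -restrict_EFin -integrable_mkcond//; exact: lf.
have i2 := integrableD measurableT (integrable_norm i1) (integrable_norm iw).
apply: le_integrable i2 => //; first exact/measurable_EFinP.
move=> x _; rewrite /= lee_fin (le_trans _ (ler_norm _))// patchE mem_setE in_itv /= -ler_norml.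
case: (leP `|x| 1) => x1; first by rewrite lerDl.
by rewrite normr0 add0r normrM ler_peMl// ltW.
Qed.

Lemma green0 b (x t : R) : green b 0 x t = jump b x t.
Proof. by rewrite /green mul0r expR0 mulr1. Qed.

Lemma integrable_jump b f x : mu.-integrable setT (EFin \o f) ->
  mu.-integrable setT (EFin \o (fun t => jump b x t * f t)).
Proof.
move=> /[dup] fi /integrableP[/measurable_EFinP mf _]; apply: le_integrable fi => //.
  apply/measurable_EFinP/measurable_funM => //.
  exact: (measurable_section1 x (@measurable_jump R b)).
by move=> t _; rewrite /= lee_fin normrM ler_piMl// jump_norm.
Qed.

Definition tail f (x : R) : R := \int[mu]_t ((`|x| <= `|t|)%R%:R * `|f t|).

(** By Tonelli, the integral of the tail is that of 2 |t| |f(t)|, since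
    |x| <= |t| describes an interval of length 2 |t|. *)
Lemma integrable_tail f : mu.-integrable setT (EFin \o f) ->
  mu.-integrable setT (EFin \o (fun x => x * f x)) ->
  mu.-integrable setT (EFin \o tail f).
Proof.
move=> /[dup] fi /integrableP[/measurable_EFinP mf _] iw.
pose F (x t : R) := (`|x| <= `|t|)%R%:R * `|f t|.
have mle : measurable_fun [set: RR] (fun z => (`|z.1| <= `|z.2|)%R%:R : R).
  rewrite (_ : (fun _ => _) = (fun z : RR => if `|z.1| <= `|z.2| then 1 else 0)).
    by apply: measurable_fun_ifT => //; apply: measurable_fun_ler; exact: measurableT_comp.
  by apply/funext => z; case: ifP.
have mF : measurable_fun [set: RR] (fun z => F z.1 z.2).
  apply: measurable_funM => //.
  by apply: measurableT_comp => //; exact: measurableT_comp.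
have F0 x t : 0 <= F x t by rewrite /F mulr_ge0// ler0n.
have iF x : mu.-integrable setT (EFin \o F x).
  apply: le_integrable fi => //.
    by apply/measurable_EFinP; exact: (measurable_section1 x mF).
  by move=> t _; rewrite /= lee_fin /F normrM normr_id ler_piMl// normr_nat lern1 leq_b1.
apply/integrableP; split.
  by apply/measurable_EFinP; exact: measurable_Rintegral_ge0.
have -> : (\int[mu]_x `|(EFin \o tail f) x| = \int[mu]_x \int[mu]_t (F x t)%:E)%E.
  apply: eq_integral => x _; rewrite Rintegral_EFin//= ger0_norm//.
  exact: Rintegral_ge0.
have := @fubini_tonelli _ _ _ _ R mu mu (fun z : RR => (F z.1 z.2)%:E).
move=> -> /=; [|exact/measurable_EFinP|by move=> z; rewrite lee_fin].
have -> : (\int[mu]_t \int[mu]_x (F x t)%:E = \int[mu]_t (2%:E * `|(t * f t)%:E|))%E.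
  apply: eq_integral => t _.
  transitivity (\int[mu]_x ((`|f t|)%:E * (\1_(`[- `|t|, `|t|]%classic) x)%:E))%E.
    apply: eq_integral => x _; rewrite /F indicE mem_setE in_itv /= -ler_norml.
    by rewrite -EFinM mulrC.
  rewrite ge0_integralZl ?lee_fin//; last exact/measurable_EFinP/measurable_indic.
  rewrite integral_indic//= setIT lebesgue_measure_itv /= lte_fin.
  have [t0|t0] := eqVneq t 0.
    by rewrite t0 mul0r /= !normr0 oppr0 ltxx !mule0.
  rewrite ifT; last by rewrite gtrN// normr_gt0.
  by rewrite -EFinB opprK -!EFinM /= normrM; congr EFin; ring.
have /integrableP[mw] := iw.
rewrite ge0_integralZl//; last exact: measurableT_comp.
have : (0 <= \int[mu]_x `|(x * f x)%:E|)%E by exact: integral_ge0.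
by move=> ge0 fin; rewrite lte_mul_pinfty.
Qed.

Lemma primitive_wderiv f : locint f -> mu.-integrable setT (EFin \o f) ->
  let F x := \int[mu]_t (jump true x t * f t) in
  [/\ measurable_fun setT F, wderiv F f & forall x, `|F x| <= \int[mu]_t `|f t|].
Proof.
move=> lf fi F; have [mf _] := lf.
have KE : (fun x => \int[mu]_t (green true 0 x t * f t)) = F.
  by apply/funext => x; apply: eq_Rintegral => t _; rewrite green0.
have mK := @measurable_green R true 0.
have Kg x : mu.-integrable setT (EFin \o (fun t => green true 0 x t * f t)).
  by have := integrable_jump true x fi; apply: eq_integrable => // t _ /=; rewrite green0.
have fn := integrable_norm fi.
have le1 x : \int[mu]_t `|green true 0 x t * f t| <= \int[mu]_t `|f t|.
  apply: le_Rintegral => //; first exact: integrable_norm (Kg x).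
  by move=> t _; rewrite green0 normrM ler_piMl// jump_norm.
have lw : locint (fun x => \int[mu]_t `|green true 0 x t * f t|).
  have mw : measurable_fun setT (fun x => \int[mu]_t `|green true 0 x t * f t|).
    apply: (@measurable_Rintegral_ge0 R (fun x t => `|green true 0 x t * f t|)) => //.
    apply: measurableT_comp => //; apply: measurable_funM => //.
    exact: measurableT_comp.
  split=> // M; apply: le_integrable ((locint_cst (\int[mu]_t `|f t|)).2 M) => //.
    by apply/measurable_EFinP; exact: measurable_funTS.
  move=> x _; rewrite /= lee_fin ger0_norm; last exact: Rintegral_ge0.
  exact: le_trans (ler_norm _).
have lK := @locint_green R true 0.
have KT phi t := @green_test R true 0 t phi.
split.
- by rewrite -KE; exact: kernel_measurable.
- have := kernel_wderiv mK lf Kg lw lK KT; rewrite KE.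
  by congr wderiv; apply/funext => x; rewrite mul0r add0r.
- by move=> x; rewrite -KE; apply: le_trans (le1 x); exact: kernel_le.
Qed.

(** As f has integral 0, its primitive from -oo is also the one from +oo, so on
    each half-line it is dominated by the tail of |f|. The primitive is thus
    integrable; being bounded, it is square integrable. *)
Lemma primitive_L2 f : L2 f -> mu.-integrable setT (EFin \o (fun x => x * f x)) ->
  \int[mu]_x f x = 0 -> exists v, L2 v /\ wderiv v f.
Proof.
move=> L2f iw f0; have lf := L2_locint L2f; have fi := integrable_weight lf iw.
have [mF dF Fb] := primitive_wderiv lf fi.
set F := (F in wderiv F f) in mF dF Fb *.
have Ff b x : F x = \int[mu]_t (jump b x t * f t).
  case: b => //; apply/eqP; rewrite -subr_eq0 -RintegralB//; [|exact: integrable_jump..].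
  apply/eqP; rewrite -[RHS]f0; apply: eq_Rintegral => t _.
  by rewrite -mulrBl jumpE mul1r.
have jump_tail x : exists b, forall t, `|jump b x t * f t| <= (`|x| <= `|t|)%R%:R * `|f t|.
  exists (x <= 0) => t; rewrite normrM ler_wpM2r// /jump.
  case: (leP x 0) => x0; case: (leP t x) => tx; rewrite ?normr0 ?ler0n// ?normr1 ?normrN1.
    by rewrite !ler0_norm ?(le_trans tx)// lerN2 tx.
  by rewrite !ger0_norm ?(ltW tx)// ltW// (lt_trans x0 tx).
have tail0 x : 0 <= tail f x by apply: Rintegral_ge0 => t _; rewrite mulr_ge0// ler0n.
have Ftail x : `|F x| <= tail f x.
  have [b jt] := jump_tail x; rewrite (Ff b x).
  have ij := integrable_jump b x fi.
  apply: le_trans (le_normr_Rintegral measurableT ij) _.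
  apply: le_Rintegral => //; first exact: integrable_norm ij.
  have [mf _] := lf.
  apply: le_integrable fi => //.
    apply/measurable_EFinP/measurable_funM; last exact: measurableT_comp.
    rewrite (_ : (fun _ => _) = (fun t => if `|x| <= `|t| then 1 else 0)).
      by apply: measurable_fun_ifT => //; apply: measurable_fun_ler => //; exact: measurableT_comp.
    by apply/funext => t; case: ifP.
  by move=> t _; rewrite /= lee_fin normrM normr_id ler_piMl// normr_nat lern1 leq_b1.
exists F; split=> //; split=> //.
have := integrableZl measurableT (\int[mu]_t `|f t|) (integrable_tail fi iw).
apply: le_integrable => //; first by apply/measurable_EFinP; exact: measurable_funX.
move=> x _; rewrite /= lee_fin (le_trans _ (ler_norm _))// normrX expr2.
by apply: ler_pM => //; first [exact: Ftail|exact: Fb].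
Qed.

(** Test the equation against chi(x / N): the left side tends to chi(0) times the
    integral of f, and the right side is the integral of v against a function of
    L2 norm O(N^(-1/2)), which tends to 0. *)
Lemma wderiv_mean0 v f : L2 v -> locint f -> mu.-integrable setT (EFin \o f) ->
  wderiv v f -> \int[mu]_x f x = 0.
Proof.
have alg1 (P n b k : R) : k != 0 ->
    (P + 2 * n * b ^+ 2) / k = k^-1 * P + k * (b / k ^+ 2) ^+ 2 * (2 * n * k ^+ 2).
  by move=> k0; field.
have alg2 (y k d : R) : k != 0 ->
    k^-1 * (y - k * d) ^+ 2 = k^-1 * y ^+ 2 + k * d ^+ 2 - 2 * (y * d).
  by move=> k0; field.
move=> [mv iv] lf fi vf; have lv := L2_locint (conj mv iv); have [mf _] := lf.
pose chi := box (- 1) 1 0 : R -> R.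
have tchi : test_function chi by exact: test_box.
have [schi [M [M0 chiM]]] := (test_functionP chi).1 tchi.
have [B [B0 chiB]] := test_bounded (test_derive1 tchi).
have [_ [N [N0 chiN]]] := (test_functionP _).1 (test_derive1 tchi).
have chi0 : chi 0 != 0.
  have f1 : flat 1 (1 : R) != 0 by rewrite /flat ltr01 hornerE mul1r gt_eqF// expR_gt0.
  by rewrite /chi /box opprK subr0 add0r !mulr1 mulf_neq0.
(* N is a square, k^2, so that weighting v^2 by 1/k and phi'^2 by k makes both O(1/k) *)
pose s (n : nat) : R := n.+1%:R ^- 2.
have s0 n : 0 < s n by rewrite invr_gt0 exprn_gt0.
pose phi n x := chi (s n * x).
have tphi n : test_function (phi n).
  apply/test_functionP; split.
    have := @smooth_affine _ chi (s n) 0 schi; congr smooth.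
    by apply/funext => x; rewrite addr0.
  exists (M / s n); split; first by rewrite divr_gt0.
  move=> x; rewrite ler_pdivrMr// => Mx; apply: chiM.
  by rewrite normrM (gtr0_norm (s0 n)) mulrC.
have dphi n x : derive1 (phi n) x = s n * derive1 chi (s n * x).
  exact/derive1_scale/smooth_is_derive.
pose V := \int[mu]_x (v x ^+ 2).
pose A n := \int[mu]_x (f x * phi n x).
have Abound n : `|A n| <= (V + 2 * N * B ^+ 2) * harmonic n.
  rewrite /A -[X in `|X|]opprK -(vf _ (tphi n)) normrN.
  have it := integrable_test lv (test_derive1 (tphi n)).
  apply: le_trans (le_normr_Rintegral measurableT it) _.
  set k : R := n.+1%:R; have k0 : 0 < k by [].
  have sk : s n = k ^- 2 by [].
  pose D := `[- (N / s n), N / s n]%classic.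
  have mD : measurable (D : set (measurableTypeR R)) by exact: measurable_itv.
  have muD : mu D = (2 * N * k ^+ 2)%:E.
    rewrite /D lebesgue_measure_itv /= lte_fin ifT; last by rewrite gtrN// divr_gt0.
    by rewrite -EFinB sk invrK; congr EFin; ring.
  have iD : mu.-integrable setT (EFin \o (\1_D : R -> R)).
    exact: integrable_indic_itv.
  have ID : \int[mu]_x (\1_D x : R) = 2 * N * k ^+ 2.
    by rewrite /Rintegral integral_indic//= setIT muD.
  have i1 := integrableZl measurableT (k^-1) iv.
  have i2 := integrableZl measurableT (k * (B * s n) ^+ 2) iD.
  have -> : (V + 2 * N * B ^+ 2) * harmonic n =
     \int[mu]_x (k^-1 * v x ^+ 2 + (k * (B * s n) ^+ 2) * \1_D x).
    rewrite RintegralD// !RintegralZl// ID -/V sk /harmonic /= -/k.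
    by rewrite alg1// gt_eqF.
  apply: le_Rintegral => //; first exact: integrable_norm it.
    by have := integrableD measurableT i1 i2; apply.
  move=> x _; rewrite indicE mem_setE in_itv /= -ler_norml.
  case: (leP `|x| (N / s n)) => xN.
    rewrite mulr1 dphi normrM.
    have db : `|s n * derive1 chi (s n * x)| <= B * s n.
      by rewrite normrM (gtr0_norm (s0 n)) mulrC ler_wpM2r// ltW.
    set d := `|s n * _| in db *.
    have d0 : 0 <= d by exact: normr_ge0.
    apply: (@le_trans _ _ (k^-1 * `|v x| ^+ 2 + k * d ^+ 2)).
      have := sqr_ge0 (`|v x| - k * d); rewrite -(pmulr_rge0 _ (_ : 0 < k^-1)) ?invr_gt0// => h.
      have E := alg2 `|v x| k d (lt0r_neq0 k0).
      have h2 : 0 <= `|v x| * d by rewrite mulr_ge0.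
      by move: h; rewrite E subr_ge0; apply: le_trans; rewrite mulr_natl mulr2n lerDl.
    rewrite real_normK ?num_real// lerD2l ler_wpM2l ?(ltW k0)//.
    by rewrite lerXn2r// nnegrE mulr_ge0 ?(ltW B0) ?(ltW (s0 n)).
  have z : derive1 chi (s n * x) = 0.
    by apply: chiN; move: xN; rewrite ltr_pdivrMr// normrM (gtr0_norm (s0 n)) mulrC => /ltW.
  by rewrite /= dphi z !mulr0 normr0 addr0 mulr_ge0 ?sqr_ge0// invr_ge0 ltW.
have [C [C0 chiC]] := test_bounded tchi.
have cvA : (fun n => \int[mu]_x (f x * phi n x)%:E)%E @ \oo --> (\int[mu]_x (f x * chi 0)%:E)%E.
  have fn := integrableZl measurableT C (integrable_norm fi).
  have [] := @dominated_convergence _ _ _ mu setT measurableT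
    (fun n x => (f x * phi n x)%:E) (fun x => (f x * chi 0)%:E) (fun x => (C * `|f x|)%:E).
  - move=> n; apply/measurable_EFinP/measurable_funM => //.
    by apply: continuous_measurable_fun; exact: test_continuous.
  - by apply/measurable_EFinP/measurable_funM.
  - apply: aeW => x _; apply: cvg_EFin; first by near=> n.
    apply: cvgMr; rewrite -[in X in _ --> chi X](mul0r x).
    apply: continuous_cvg; first exact: (smooth_continuous schi).
    apply: cvgMl; rewrite /s -(mulr0 0).
    under eq_fun do rewrite expr2 invfM.
    by apply: cvgM; exact: cvg_harmonic.
  - exact: fn.
  - by apply: aeW => x n _; rewrite /= lee_fin normrM mulrC ler_wpM2r//; exact: chiC.
  - by [].
have AE n : (\int[mu]_x (f x * phi n x)%:E)%E = (A n)%:E.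
  by rewrite Rintegral_EFin//; exact: integrable_test.
have iE : (\int[mu]_x (f x * chi 0)%:E)%E = (chi 0 * \int[mu]_x f x)%:E.
  rewrite Rintegral_EFin//; first by rewrite RintegralZr// mulrC.
  by have := integrableZr measurableT (chi 0) fi.
rewrite iE in cvA; move: cvA; under eq_fun do rewrite AE; move=> cvA.
have cvA' : A n @[n --> \oo] --> chi 0 * \int[mu]_x f x by exact: fine_cvg cvA.
have h0 : (V + 2 * N * B ^+ 2) * harmonic n @[n --> \oo] --> (0 : R).
  by rewrite -(mulr0 (V + 2 * N * B ^+ 2)); apply: cvgMr; exact: cvg_harmonic.
have hN : - ((V + 2 * N * B ^+ 2) * harmonic n) @[n --> \oo] --> (0 : R).
  by rewrite -oppr0; exact: cvgN.
have A0 : A n @[n --> \oo] --> (0 : R).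
  by apply: squeeze_cvgr hN h0; near=> n; rewrite -ler_norml.
have E : chi 0 * \int[mu]_x f x = 0 := cvg_unique (@Rhausdorff R) cvA' A0.
by apply: (mulfI chi0); rewrite E mulr0.
Unshelve. all: by end_near. Qed.

End Primitive.

(** * Complex-valued functions *)

Section Complex.
Variable R : realType.
Notation mu := (@lebesgue_measure R).
Notation C := R[i].
Implicit Types (f g u v w : R -> C) (a b : R) (l : C).
Notation re u := (fun x => complex.Re (u x)).
Notation im u := (fun x => complex.Im (u x)).

Lemma normc_sqr (z : C) : Normc.normc z ^+ 2 = complex.Re z ^+ 2 + complex.Im z ^+ 2.
Proof. by case: z => x y /=; rewrite sqr_sqrtr// addr_ge0 ?sqr_ge0. Qed.

Lemma normc_ge0 (z : C) : 0 <= Normc.normc z.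
Proof. by case: z => x y /=; exact: sqrtr_ge0. Qed.

Lemma normc_ge_Re_Im (z : C) :
  `|complex.Re z| <= Normc.normc z /\ `|complex.Im z| <= Normc.normc z.
Proof.
by split; rewrite -(@ler_pXn2r _ 2) ?nnegrE ?normc_ge0// normc_sqr real_normK ?num_real//;
  rewrite ?lerDl ?lerDr sqr_ge0.
Qed.

Lemma measurable_normc u : cmeasurable u -> measurable_fun setT (fun x => Normc.normc (u x)).
Proof.
move=> [mr mi].
have -> : (fun x => Normc.normc (u x)) =
    (fun x => Num.sqrt (complex.Re (u x) ^+ 2 + complex.Im (u x) ^+ 2)).
  by apply/funext => x; case: (u x).
apply: (@measurableT_comp _ _ _ _ _ _ (@Num.sqrt R)).
  by apply: continuous_measurable_fun; exact: sqrt_continuous.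
by apply: measurable_funD; exact: measurable_funX.
Qed.

Lemma cLp2P u : cLp 2%:E u <-> L2 (re u) /\ L2 (im u).
Proof.
have normE x : (`|(EFin \o (fun x => Normc.normc (u x))) x| `^ 2 =
    (complex.Re (u x) ^+ 2 + complex.Im (u x) ^+ 2)%:E)%E.
  by rewrite /= ger0_norm ?normc_ge0// powR_mulrn ?normc_ge0// normc_sqr.
have intE : (('N[mu]_2%:E[EFin \o (fun x => Normc.normc (u x))] `^ 2) =
    \int[mu]_x (complex.Re (u x) ^+ 2 + complex.Im (u x) ^+ 2)%:E)%E.
  by rewrite powR_Lnorm//; apply: eq_integral => x _; exact: normE.
split=> [[[mr mi] fin]|[[mr ir] [mi ii]]].
  have i2 : mu.-integrable setT
      (EFin \o (fun x => complex.Re (u x) ^+ 2 + complex.Im (u x) ^+ 2)).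
    apply/integrableP; split.
      by apply/measurable_EFinP; apply: measurable_funD; exact: measurable_funX.
    under eq_integral do rewrite /= ger0_norm ?addr_ge0 ?sqr_ge0//.
    by rewrite -intE; exact: poweR_lty.
  split; split=> //; apply: le_integrable i2 => //.
  - by apply/measurable_EFinP; exact: measurable_funX.
  - by move=> x _; rewrite /= lee_fin !ger0_norm ?addr_ge0 ?sqr_ge0// lerDl sqr_ge0.
  - by apply/measurable_EFinP; exact: measurable_funX.
  - by move=> x _; rewrite /= lee_fin !ger0_norm ?addr_ge0 ?sqr_ge0// lerDr sqr_ge0.
split=> //; apply: (@lty_poweRy _ _ 2); first by rewrite pnatr_eq0.
rewrite intE; have := integrable_lty measurableT (integrableD measurableT ir ii).
exact.
Qed.

Lemma cL1_integrable u : cLp 1%:E u ->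
  mu.-integrable setT (EFin \o re u) /\ mu.-integrable setT (EFin \o im u).
Proof.
move=> [mu_ fin]; have mn := measurable_normc mu_; have [mr mi] := mu_.
have i1 : mu.-integrable setT (EFin \o (fun x => Normc.normc (u x))).
  apply/integrableP; split; first exact/measurable_EFinP.
  by move: fin; rewrite /finite_norm Lnorm1.
split; apply: le_integrable i1 => //; try exact/measurable_EFinP.
  by move=> x _; rewrite /= lee_fin [leRHS]ger0_norm ?normc_ge0//; have [] := normc_ge_Re_Im (u x).
by move=> x _; rewrite /= lee_fin [leRHS]ger0_norm ?normc_ge0//; have [] := normc_ge_Re_Im (u x).
Qed.

Lemma cintegral_real u (phi : R -> R) : cintegral (fun x => u x * (phi x)%:C) =
  (\int[mu]_x (complex.Re (u x) * phi x)) +i* (\int[mu]_x (complex.Im (u x) * phi x)).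
Proof.
rewrite /cintegral; congr (_ +i* _); apply: eq_Rintegral => x _; case: (u x) => p q /=.
  by rewrite mulr0 subr0.
by rewrite mulr0 add0r.
Qed.

Lemma weak_derivative1P u v : weak_derivative 1 u v <->
  wderiv (re u) (re v) /\ wderiv (im u) (im v).
Proof.
split=> [uv|[uvr uvi] phi tphi].
  by split=> phi tphi; have := uv _ tphi; rewrite !cintegral_real expr1 mulN1r => -[].
by rewrite !cintegral_real expr1 mulN1r (uvr _ tphi) (uvi _ tphi).
Qed.

Lemma weak_derivative_comp n u v w :
  weak_derivative 1 u v -> weak_derivative n v w -> weak_derivative n.+1 u w.
Proof.
move=> uv vw phi tphi.
have := uv _ (test_derive1n n tphi); rewrite /derive1n -iterS expr1 => ->.
by rewrite (vw _ tphi) mulrA -exprS.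
Qed.

(** Only derivatives of u itself are given in a Sobolev space; this recovers that
    each is the weak derivative of the previous one. *)
Lemma weak_derivative_step n u v w :
  weak_derivative n u v -> weak_derivative n.+1 u w -> weak_derivative 1 v w.
Proof.
move=> uv uw phi tphi; apply: (@mulrI _ ((-1) ^+ n)); first exact: rpredX (unitrN1 _).
have := uw _ tphi; rewrite derive1Sn (uv _ (test_derive1 tphi)) => ->.
by rewrite expr1 exprSr mulrA.
Qed.

Definition L2deriv u v := [/\ cLp 2%:E u, cLp 2%:E v & weak_derivative 1 u v].

Lemma L2deriv_ae u v v' : {ae mu, forall x, v x = v' x} -> cLp 2%:E v' -> L2deriv u v -> L2deriv u v'.
Proof.
move=> vv' L2v' [L2u L2v uv]; split=> //.
have [Lur Lui] := (cLp2P u).1 L2u; have [Lvr Lvi] := (cLp2P v).1 L2v.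
have [Lvr' Lvi'] := (cLp2P v').1 L2v'; have [uvr uvi] := (weak_derivative1P u v).1 uv.
have id0 (h : R -> R) : {ae mu, forall x, h x = h x} by exact: aeW.
apply/weak_derivative1P; split.
  apply: (wderiv_ae _ _ _ _ (id0 _) _ uvr); try exact: L2_locint.
  by apply: ae_mono vv' => x ->.
apply: (wderiv_ae _ _ _ _ (id0 _) _ uvi); try exact: L2_locint.
by apply: ae_mono vv' => x ->.
Qed.

Lemma cL2_lin l u v : cLp 2%:E u -> cLp 2%:E v -> cLp 2%:E (fun x => l * u x + v x).
Proof.
move=> /cLp2P[ur ui] /cLp2P[vr vi]; case: l => p q; apply/cLp2P; split.
  have := L2D (L2D (L2Z p ur) (L2Z (- q) ui)) vr; congr L2; apply/funext => x.
  by case: (u x) => ? ?; case: (v x) => ? ? /=; rewrite mulNr.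
have := L2D (L2D (L2Z p ui) (L2Z q ur)) vi; congr L2; apply/funext => x.
by case: (u x) => ? ?; case: (v x) => ? ? /=.
Qed.

Lemma L2deriv_lin l u u' v v' : L2deriv u u' -> L2deriv v v' ->
  L2deriv (fun x => l * u x + v x) (fun x => l * u' x + v' x).
Proof.
move=> [Lu Lu' uu'] [Lv Lv' vv']; split; [exact: cL2_lin..|].
have [ur ui] := (cLp2P u).1 Lu; have [ur' ui'] := (cLp2P u').1 Lu'.
have [vr vi] := (cLp2P v).1 Lv; have [vr' vi'] := (cLp2P v').1 Lv'.
have [wur wui] := (weak_derivative1P u u').1 uu'; have [wvr wvi] := (weak_derivative1P v v').1 vv'.
have lZ (c : R) h (Lh : L2 h) := L2_locint (L2Z c Lh).
have lZD (c d : R) h k (Lh : L2 h) (Lk : L2 k) := L2_locint (L2D (L2Z c Lh) (L2Z d Lk)).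
have wZ (c : R) h k (Lh : L2 h) (Lk : L2 k) := @wderivZ _ c _ _ (L2_locint Lh) (L2_locint Lk).
case: l => p q; apply/weak_derivative1P; split.
  have := wderivD (lZD p (- q) _ _ ur ui) (L2_locint vr) (lZD p (- q) _ _ ur' ui') (L2_locint vr')
    (wderivD (lZ p _ ur) (lZ (- q) _ ui) (lZ p _ ur') (lZ (- q) _ ui') (wZ p _ _ ur ur' wur) (wZ (- q) _ _ ui ui' wui)) wvr.
  by congr wderiv; apply/funext => x;
    [case: (u x) => ? ?; case: (v x) => ? ?|case: (u' x) => ? ?; case: (v' x) => ? ?];
    rewrite /= mulNr.
have := wderivD (lZD p q _ _ ui ur) (L2_locint vi) (lZD p q _ _ ui' ur') (L2_locint vi')
    (wderivD (lZ p _ ui) (lZ q _ ur) (lZ p _ ui') (lZ q _ ur') (wZ p _ _ ui ui' wui) (wZ q _ _ ur ur' wur)) wvi.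
by congr wderiv; apply/funext => x;
    [case: (u x) => ? ?; case: (v x) => ? ?|case: (u' x) => ? ?; case: (v' x) => ? ?].
Qed.

End Complex.

(** * First-order equations with a complex coefficient *)

Section ComplexFirstOrder.
Variable R : realType.
Notation mu := (@lebesgue_measure R).
Notation C := R[i].
Implicit Types (f g u v w : R -> C) (a b : R) (l : C).
Notation re u := (fun x => complex.Re (u x)).
Notation im u := (fun x => complex.Im (u x)).

(** exp(i b x); multiplying by it shifts the coefficient of a first-order
    equation by i b, which reduces complex coefficients to real ones. *)
Definition cis b (x : R) : C := cos (b * x) +i* sin (b * x).

Lemma cisN b x : cis b x * cis (- b) x = 1.
Proof.
rewrite /cis mulNr cosN sinN /=; apply/eqP; rewrite eq_complex /=; apply/andP; split.
  by rewrite mulrN opprK -!expr2 cos2Dsin2.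
by rewrite mulrN mulrC addNr.
Qed.

Lemma cL2_cis b u : cLp 2%:E u -> cLp 2%:E (fun x => cis b x * u x).
Proof.
move=> /cLp2P[ur ui]; apply/cLp2P.
have mc : measurable_fun setT (fun x : R => cos (b * x)).
  by apply: continuous_measurable_fun; exact/smooth_continuous/smooth_cos.
have ms : measurable_fun setT (fun x : R => sin (b * x)).
  by apply: continuous_measurable_fun; exact/smooth_continuous/smooth_sin.
have cb (x : R) : `|cos (b * x)| <= 1 by rewrite ler_norml cos_geN1 cos_le1.
have sb (x : R) : `|sin (b * x)| <= 1 by rewrite ler_norml sin_geN1 sin_le1.
split.
  have := L2D (L2M mc cb ur) (L2Z (-1) (L2M ms sb ui)); congr L2; apply/funext => x.
  by case: (u x) => ? ? /=; rewrite mulN1r.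
have := L2D (L2M mc cb ui) (L2M ms sb ur); congr L2; apply/funext => x.
by case: (u x) => ? ? /=.
Qed.

Lemma L2deriv_cis b u v : L2deriv u v ->
  L2deriv (fun x => cis b x * u x) (fun x => cis b x * ((0 +i* b) * u x + v x)).
Proof.
move=> [Lu Lv uv]; split; [exact: cL2_cis|exact/cL2_cis/cL2_lin|].
have [ur ui] := (cLp2P u).1 Lu; have [vr vi] := (cLp2P v).1 Lv.
have [wr wi] := (weak_derivative1P u v).1 uv.
have lur := L2_locint ur; have lui := L2_locint ui.
have lvr := L2_locint vr; have lvi := L2_locint vi.
have sc := @smooth_cos R b; have ss := @smooth_sin R b.
have sns : smooth (fun x : R => -1 * sin (b * x)) by exact: (smoothM (@smooth_cst R (-1)) ss).
have mulc (h c : R -> R) : smooth c -> locint h -> locint (fun x => c x * h x).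
  move=> sf lh; have := locintM lh (smooth_continuous sf); congr locint.
  by apply/funext => x; rewrite mulrC.
have wM (h k c : R -> R) (sf : smooth c) (lh : locint h) (lk : locint k) (hk : wderiv h k) :=
  wderivM sf lh lk hk.
have lM (h k c : R -> R) (sf : smooth c) (lh : locint h) (lk : locint k) :
    locint (fun x => derive1 c x * h x + c x * k x).
  exact: (locintD (mulc _ _ (smooth_derive1 sf) lh) (mulc _ _ sf lk)).
have dns (x : R) : derive1 (fun x : R => -1 * sin (b * x)) x = - (b * cos (b * x)).
  rewrite (derive1_mul (@smooth_cst R (-1)) ss).
  by rewrite derive1_sin derive1_cst mulr0 addr0 mulN1r.
apply/weak_derivative1P; split.
  have := wderivD (mulc _ _ sc lur) (mulc _ _ sns lui) (lM _ _ _ sc lur lvr) (lM _ _ _ sns lui lvi)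
    (wM _ _ _ sc lur lvr wr) (wM _ _ _ sns lui lvi wi).
  congr wderiv; apply/funext => x; case: (u x) => p q; first by rewrite /=; ring.
  by rewrite dns derive1_cos; case: (v x) => y z /=; ring.
have := wderivD (mulc _ _ ss lur) (mulc _ _ sc lui) (lM _ _ _ ss lur lvr) (lM _ _ _ sc lui lvi)
    (wM _ _ _ ss lur lvr wr) (wM _ _ _ sc lui lvi wi).
congr wderiv; apply/funext => x; case: (u x) => p q; first by rewrite /=; ring.
by rewrite derive1_sin derive1_cos; case: (v x) => y z /=; ring.
Qed.

Lemma complexE' l : l = (complex.Re l)%:C + (0 +i* complex.Im l).
Proof. by case: l => p q; apply/eqP; rewrite eq_complex /= addr0 add0r !eqxx. Qed.

(** Conjugation by exp(i Im(l) x) turns the equation into two real ones, for the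
    real and imaginary parts, with the coefficient Re l. *)
Lemma L2deriv_solve l g : complex.Re l != 0 -> cLp 2%:E g ->
  exists u, L2deriv u (fun x => l * u x + g x).
Proof.
move=> l0 Lg; set a := complex.Re l in l0 *; set b := complex.Im l.
have LG := cL2_cis (- b) Lg; have [Gr Gi] := (cLp2P _).1 LG.
have [U1 [LU1 wU1]] := first_order_real l0 Gr.
have [U2 [LU2 wU2]] := first_order_real l0 Gi.
pose U x : C := U1 x +i* U2 x.
have LU : cLp 2%:E U by apply/cLp2P.
have DU : L2deriv U (fun x => a%:C * U x + cis (- b) x * g x).
  split=> //; first exact: cL2_lin.
  apply/weak_derivative1P; split.
    move: wU1; congr wderiv; apply/funext => x.
    by rewrite [in RHS]/U; case: (cis _ _ * _) => p q /=; rewrite mul0r subr0.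
  move: wU2; congr wderiv; apply/funext => x.
  by rewrite [in RHS]/U; case: (cis _ _ * _) => p q /=; rewrite mul0r addr0.
exists (fun x => cis b x * U x); have := L2deriv_cis b DU; congr L2deriv; apply/funext => x.
transitivity ((a%:C + (0 +i* b)) * (cis b x * U x) + (cis b x * cis (- b) x) * g x).
  by ring.
by rewrite cisN mul1r -complexE'.
Qed.

(** The rotation exp(-i Im(l) x) makes the coefficient real, and then the real
    and imaginary parts vanish by uniqueness for real equations. *)
Lemma L2deriv_root l v v' : L2deriv v v' -> {ae mu, forall x, v' x - l * v x = 0} ->
  {ae mu, forall x, v x = 0}.
Proof.
move=> Dv vv'; set a := complex.Re l; set b := complex.Im l.
have [Lv _ _] := Dv.
have Llv : cLp 2%:E (fun x => l * v x).
  have := cL2_lin (l - 1) Lv Lv; congr cLp; apply/funext => x.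
  by rewrite mulrBl mul1r subrK.
have {}Dv : L2deriv v (fun x => l * v x).
  by apply: L2deriv_ae Dv => //; apply: ae_mono vv' => x /eqP; rewrite subr_eq0 => /eqP.
have := L2deriv_cis (- b) Dv; set V := (fun x => cis (- b) x * v x) => -[LV LV' /weak_derivative1P[wr wi]].
have [Vr Vi] := (cLp2P V).1 LV.
have E x : cis (- b) x * ((0 +i* - b) * v x + l * v x) = a%:C * V x.
  have -> : (0 +i* - b : C) = - (0 +i* b) by apply/eqP; rewrite eq_complex /= oppr0 !eqxx.
  by rewrite [X in _ + X * _ ](complexE' l) /V; ring.
have Vr0 : {ae mu, forall x, complex.Re (V x) = 0}.
  apply: (@L2_wderiv_exp _ a) => //; move: wr; congr wderiv; apply/funext => x.
  by rewrite E; case: (V x) => p q /=; rewrite mul0r subr0.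
have Vi0 : {ae mu, forall x, complex.Im (V x) = 0}.
  apply: (@L2_wderiv_exp _ a) => //; move: wi; congr wderiv; apply/funext => x.
  by rewrite E; case: (V x) => p q /=; rewrite mul0r addr0.
apply: ae_mono2 Vr0 Vi0 => x r0 i0.
have V0 : V x = 0 by apply/eqP; rewrite eq_complex r0 i0 !eqxx.
by rewrite -[v x]mul1r -(cisN b x) -mulrA -/(V x) V0 mulr0.
Qed.

End ComplexFirstOrder.

(** * The fourth-order equation *)

Section FourthOrder.
Variable R : realType.
Notation mu := (@lebesgue_measure R).
Notation C := R[i].
Implicit Types (f g u v w : R -> C) (a b : R) (l : C).

(** The third derivative, absent from the equation, completes the chain that
    the factorisation of the operator acts on. *)
Lemma H4_solutionP a b f u : H4_solution a b f u <->
  exists u1 u2 u3 u4, [/\ L2deriv u u1, L2deriv u1 u2, L2deriv u2 u3, L2deriv u3 u4 &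
    {ae mu, forall x, - u2 x + u4 x - b%:C * u1 x - a%:C * u x = f x}].
Proof.
split=> [[[Lu Hu] [d1 [d2 [d4 [[Ld1 w1] [Ld2 w2] [Ld4 w4] eqn]]]]]|].
  have [//|u3 Lu3 w3] := Hu 3%N.
  exists d1, d2, u3, d4; split=> //; split=> //.
  - exact: weak_derivative_step w1 w2.
  - exact: weak_derivative_step w2 w3.
  - exact: weak_derivative_step w3 w4.
move=> [u1 [u2 [u3 [u4 [[Lu Lu1 w1] [_ Lu2 w2] [_ Lu3 w3] [_ Lu4 w4] eqn]]]]].
have W2 := weak_derivative_comp w1 w2; have W3 := weak_derivative_comp w1 (weak_derivative_comp w2 w3).
have W4 := weak_derivative_comp w1 (weak_derivative_comp w2 (weak_derivative_comp w3 w4)).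
split; last by exists u1, u2, u4.
split=> // -[|[|[|[|[|//]]]]] _; [exists u|exists u1|exists u2|exists u3|exists u4] => //.
by move=> phi tphi; rewrite expr0 mul1r.
Qed.

(** The numbers l1, ..., l4 are the roots of X^4 - X^2 - b X - a; the factorisation
    is kept in the form of identities between coefficients. *)
Definition vieta a b (l1 l2 l3 l4 : C) := [/\ l1 + l2 + l3 + l4 = 0,
  l1 * l2 + l1 * l3 + l1 * l4 + l2 * l3 + l2 * l4 + l3 * l4 = -1,
  l1 * l2 * l3 + l1 * l2 * l4 + l1 * l3 * l4 + l2 * l3 * l4 = b%:C &
  l1 * l2 * l3 * l4 = - a%:C].

Lemma vieta_exists a b : exists l1 l2 l3 l4, vieta a b l1 l2 l3 l4.
Proof.
pose p : {poly C} := Poly [:: - a%:C; - b%:C; -1; 0; 1].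
have sp : size p = 5%N by rewrite (@PolyK _ 1) //= oner_neq0.
have lp : lead_coef p = 1 by rewrite lead_coefE sp coef_Poly.
have [r] := closed_field_poly_normal p; rewrite lp scale1r => pr.
have := congr1 (fun q : {poly C} => size q) pr; rewrite sp size_prod_XsubC => -[].
case: r pr => [|l1 [|l2 [|l3 [|l4 [|]]]]] // pr _.
exists l1, l2, l3, l4; move: pr; rewrite !big_cons big_nil mulr1 => pr.
pose e1 := l1 + l2 + l3 + l4.
pose e2 := l1 * l2 + l1 * l3 + l1 * l4 + l2 * l3 + l2 * l4 + l3 * l4.
pose e3 := l1 * l2 * l3 + l1 * l2 * l4 + l1 * l3 * l4 + l2 * l3 * l4.
pose e4 := l1 * l2 * l3 * l4.
have E : p = Poly [:: e4; - e3; e2; - e1; 1].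
  rewrite pr /= !cons_poly_def /e1 /e2 /e3 /e4.
  rewrite !(polyCD, polyCN, polyCM) polyC1 polyC0; ring.
have coef i : (Poly [:: e4; - e3; e2; - e1; 1])`_i = (Poly [:: - a%:C; - b%:C; -1; 0; 1])`_i.
  by rewrite -E.
split.
- by have := coef 3%N; rewrite !coef_Poly /= => /eqP; rewrite oppr_eq0 => /eqP.
- by have := coef 2%N; rewrite !coef_Poly.
- by have := coef 1%N; rewrite !coef_Poly /= => /oppr_inj.
- by have := coef 0%N; rewrite !coef_Poly.
Qed.

Lemma vieta_root a b l1 l2 l3 l4 l : vieta a b l1 l2 l3 l4 ->
  l \in [:: l1; l2; l3; l4] -> l ^+ 4 - l ^+ 2 - b%:C * l - a%:C = 0.
Proof.
move=> [e1 e2 e3 e4] ll.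
have : (l - l1) * (l - l2) * (l - l3) * (l - l4) = 0.
  by move: ll; rewrite !inE => /or4P[] /eqP ->; rewrite subrr ?(mul0r,mulr0).
have -> : (l - l1) * (l - l2) * (l - l3) * (l - l4) = l ^+ 4
  - (l1 + l2 + l3 + l4) * l ^+ 3
  + (l1 * l2 + l1 * l3 + l1 * l4 + l2 * l3 + l2 * l4 + l3 * l4) * l ^+ 2
  - (l1 * l2 * l3 + l1 * l2 * l4 + l1 * l3 * l4 + l2 * l3 * l4) * l
  + l1 * l2 * l3 * l4 by ring.
by rewrite e1 e2 e3 e4 mul0r subr0 mulN1r.
Qed.

(** At l = i q the imaginary part of the symbol is -b q. *)
Lemma symbol_imaginary_root a b l : b != 0 -> complex.Re l = 0 ->
  l ^+ 4 - l ^+ 2 - b%:C * l - a%:C = 0 -> l = 0 /\ a = 0.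
Proof.
move=> b0; case: l => p q /= ->.
rewrite !exprS expr0 => /eqP; rewrite eq_complex /= => /andP[/eqP rE /eqP iE].
have q0 : q = 0.
  apply/eqP; have /eqP : b * q = 0 by move: iE; rewrite !(mul0r, mulr0); lra.
  by rewrite mulf_eq0 (negbTE b0).
move: rE; rewrite q0 !(mul0r, mulr0) => rE; split=> //; lra.
Qed.

(** Solving (d/dx - l4) g3 = f, (d/dx - l3) g2 = g3, (d/dx - l2) g1 = g2 and
    (d/dx - l1) u = g1 solves the equation: each derivative of u is a combination
    of u, g1, g2, g3 and f. *)
Lemma chain_solution a b l1 l2 l3 l4 f g1 g2 g3 u : vieta a b l1 l2 l3 l4 ->
  L2deriv g3 (fun x => l4 * g3 x + f x) -> L2deriv g2 (fun x => l3 * g2 x + g3 x) ->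
  L2deriv g1 (fun x => l2 * g1 x + g2 x) -> L2deriv u (fun x => l1 * u x + g1 x) ->
  H4_solution a b f u.
Proof.
move=> [e1 e2 e3 e4] D3 D2 D1 D0.
have D2' := L2deriv_lin l3 D2 D3; have D1' := L2deriv_lin l2 D1 D2; have D1'' := L2deriv_lin l2 D1' D2'.
have D0' := L2deriv_lin l1 D0 D1; have D0'' := L2deriv_lin l1 D0' D1'; have D0''' := L2deriv_lin l1 D0'' D1''.
apply/H4_solutionP; do 4 eexists; split; [exact: D0|exact: D0'|exact: D0''|exact: D0'''|].
apply: aeW => x; rewrite -[RHS]add0r.
have aE : a%:C = - (l1 * l2 * l3 * l4) by rewrite e4 opprK.
have mE : -1 = l1 * l2 + l1 * l3 + l1 * l4 + l2 * l3 + l2 * l4 + l3 * l4 by rewrite e2.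
rewrite -(mulN1r (l1 * _ + _)) aE -e3 mE.
have -> : l4 = - (l1 + l2 + l3) by apply/eqP; rewrite -addr_eq0 addrC e1.
by ring.
Qed.

(** The difference of two solutions is killed by the product of the operators
    d/dx - l, each of which is injective in L2. *)
Lemma H4_unique a b f u v : H4_solution a b f u -> H4_solution a b f v ->
  {ae mu, forall x, v x = u x}.
Proof.
move=> /H4_solutionP[u1 [u2 [u3 [u4 [Du Du1 Du2 Du3 eu]]]]].
move=> /H4_solutionP[v1 [v2 [v3 [v4 [Dv Dv1 Dv2 Dv3 ev]]]]].
have [l1 [l2 [l3 [l4 [e1 e2 e3 e4]]]]] := vieta_exists a b.
have W0 := L2deriv_lin (-1) Du Dv; have W1 := L2deriv_lin (-1) Du1 Dv1.
have W2 := L2deriv_lin (-1) Du2 Dv2; have W3 := L2deriv_lin (-1) Du3 Dv3.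
have G0 := L2deriv_lin (- l1) W0 W1; have G1 := L2deriv_lin (- l1) W1 W2; have G2 := L2deriv_lin (- l1) W2 W3.
have H0 := L2deriv_lin (- l2) G0 G1; have H1 := L2deriv_lin (- l2) G1 G2.
have K0 := L2deriv_lin (- l3) H0 H1.
have shift l (y z : C) : - l * y + z = 0 -> z - l * y = 0.
  by rewrite mulNr addrC.
have w0 : {ae mu, forall x, -1 * u x + v x = 0}.
  apply: (L2deriv_root (l := l1) W0); apply: (ae_mono (fun x => shift l1 _ _)).
  apply: (L2deriv_root (l := l2) G0); apply: (ae_mono (fun x => shift l2 _ _)).
  apply: (L2deriv_root (l := l3) H0); apply: (ae_mono (fun x => shift l3 _ _)).
  apply: (L2deriv_root (l := l4) K0); apply: ae_mono2 eu ev => x eux evx.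
  have : (- v2 x + v4 x - b%:C * v1 x - a%:C * v x) -
         (- u2 x + u4 x - b%:C * u1 x - a%:C * u x) = 0 by rewrite eux evx subrr.
  move=> <-; transitivity ((-1 * u4 x + v4 x)
    - (l1 + l2 + l3 + l4) * (-1 * u3 x + v3 x)
    + (l1 * l2 + l1 * l3 + l1 * l4 + l2 * l3 + l2 * l4 + l3 * l4) * (-1 * u2 x + v2 x)
    - (l1 * l2 * l3 + l1 * l2 * l4 + l1 * l3 * l4 + l2 * l3 * l4) * (-1 * u1 x + v1 x)
    + l1 * l2 * l3 * l4 * (-1 * u x + v x)); first by ring.
  by rewrite e1 e2 e3 e4; ring.
by apply: ae_mono w0 => x; rewrite mulN1r addrC => /eqP; rewrite subr_eq0 => /eqP.
Qed.

Lemma roots_nonzero_Re a b l1 l2 l3 l4 : 0 < a -> b != 0 -> vieta a b l1 l2 l3 l4 ->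
  forall l, l \in [:: l1; l2; l3; l4] -> complex.Re l != 0.
Proof.
move=> a0 b0 V l ll; apply/eqP => l0.
have [_ az] := symbol_imaginary_root b0 l0 (vieta_root V ll).
by move: a0; rewrite az ltxx.
Qed.

Lemma H4_exists_pos a b f : 0 < a -> b != 0 -> cLp 2%:E f -> exists u, H4_solution a b f u.
Proof.
move=> a0 b0 Lf; have [l1 [l2 [l3 [l4 V]]]] := vieta_exists a b.
have Re0 := roots_nonzero_Re a0 b0 V.
have [g3 D3] : exists g, L2deriv g (fun x => l4 * g x + f x).
  by apply: L2deriv_solve => //; apply: Re0; rewrite !inE eqxx !orbT.
have [L3 _ _] := D3; have [g2 D2] : exists g, L2deriv g (fun x => l3 * g x + g3 x).
  by apply: L2deriv_solve => //; apply: Re0; rewrite !inE eqxx !orbT.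
have [L2' _ _] := D2; have [g1 D1] : exists g, L2deriv g (fun x => l2 * g x + g2 x).
  by apply: L2deriv_solve => //; apply: Re0; rewrite !inE eqxx !orbT.
have [L1 _ _] := D1; have [u D0] : exists g, L2deriv g (fun x => l1 * g x + g1 x).
  by apply: L2deriv_solve => //; apply: Re0; rewrite !inE eqxx.
by exists u; exact: chain_solution V D3 D2 D1 D0.
Qed.

(** Were 0 a multiple root, the product of the other three roots, which is b,
    would vanish. *)
Lemma vieta_zero b : b != 0 -> exists l1 l2 l3, vieta 0 b l1 l2 l3 0 /\
  forall l, l \in [:: l1; l2; l3] -> complex.Re l != 0.
Proof.
move=> b0; suff [l1 [l2 [l3 V]]] : exists l1 l2 l3, vieta 0 b l1 l2 l3 0.
  exists l1, l2, l3; split=> // l ll; apply/eqP => l0.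
  have l4 : l \in [:: l1; l2; l3; 0].
    by move: ll; rewrite !inE => /or3P[] ->; rewrite ?orbT.
  have [lz _] := symbol_imaginary_root b0 l0 (vieta_root V l4).
  have [_ _ e3 _] := V; move: ll; rewrite lz !inE => lz'.
  have : b%:C = 0 :> C.
    by rewrite -e3; case/or3P: lz' => /eqP <-; rewrite !(mulr0, mul0r, addr0).
  by move=> /(congr1 (@complex.Re R)) /= /eqP; rewrite (negbTE b0).
have [l1 [l2 [l3 [l4 [e1 e2 e3 e4]]]]] := vieta_exists 0 b.
have /eqP : l1 * l2 * l3 * l4 = 0 by rewrite e4 oppr0.
rewrite !mulf_eq0 -!orbA => /or4P[] /eqP z.
- exists l4, l2, l3; split; rewrite ?oppr0 ?mulr0//.
  + by rewrite -[RHS]e1 z; ring.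
  + by rewrite -[RHS]e2 z; ring.
  + by rewrite -[RHS]e3 z; ring.
- exists l1, l4, l3; split; rewrite ?oppr0 ?mulr0//.
  + by rewrite -[RHS]e1 z; ring.
  + by rewrite -[RHS]e2 z; ring.
  + by rewrite -[RHS]e3 z; ring.
- exists l1, l2, l4; split; rewrite ?oppr0 ?mulr0//.
  + by rewrite -[RHS]e1 z; ring.
  + by rewrite -[RHS]e2 z; ring.
  + by rewrite -[RHS]e3 z; ring.
by exists l1, l2, l3; rewrite -z.
Qed.

Lemma cintegral0 f : cintegral f = 0 <->
  \int[mu]_x complex.Re (f x) = 0 /\ \int[mu]_x complex.Im (f x) = 0.
Proof. by rewrite /cintegral; split=> [[-> ->]|[-> ->]]. Qed.

Lemma L2dot1 f : L2dot f (fun=> 1) = cintegral f.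
Proof.
rewrite /L2dot; congr cintegral; apply/funext => x.
by case: (f x) => p q; apply/eqP; rewrite eq_complex /= !(mulr1, mulr0, oppr0, subr0, add0r) !eqxx.
Qed.

Lemma cL1_weight f : cLp 1%:E (fun x : R => x%:C * f x) ->
  mu.-integrable setT (EFin \o (fun x => x * complex.Re (f x))) /\
  mu.-integrable setT (EFin \o (fun x => x * complex.Im (f x))).
Proof.
move=> /cL1_integrable[ir ii]; split.
  by apply: eq_integrable ir => // x _ /=; case: (f x) => p q /=; rewrite mul0r subr0.
by apply: eq_integrable ii => // x _ /=; case: (f x) => p q /=; rewrite mul0r addr0.
Qed.

(** The factor d/dx coming from the root 0 is inverted first, on f itself: this
    is where the vanishing mean and the weight x f are used. *)
Lemma H4_exists_zero b f : b != 0 -> cLp 2%:E f ->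
  cLp 1%:E (fun x : R => x%:C * f x) -> cintegral f = 0 -> exists u, H4_solution 0 b f u.
Proof.
move=> b0 Lf /cL1_weight[iwr iwi] /cintegral0[fr0 fi0].
have [Lr Li] := (cLp2P f).1 Lf.
have [l1 [l2 [l3 [V Re0]]]] := vieta_zero b0.
have [p [Lp wp]] := primitive_L2 Lr iwr fr0.
have [q [Lq wq]] := primitive_L2 Li iwi fi0.
pose g3 x : C := p x +i* q x.
have L3 : cLp 2%:E g3 by apply/cLp2P.
have D3 : L2deriv g3 (fun x => 0 * g3 x + f x).
  have -> : (fun x => 0 * g3 x + f x) = f by apply/funext => x; rewrite mul0r add0r.
  by split=> //; apply/weak_derivative1P.
have [g2 D2] : exists g, L2deriv g (fun x => l3 * g x + g3 x).
  by apply: L2deriv_solve => //; apply: Re0; rewrite !inE eqxx !orbT.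
have [L2' _ _] := D2; have [g1 D1] : exists g, L2deriv g (fun x => l2 * g x + g2 x).
  by apply: L2deriv_solve => //; apply: Re0; rewrite !inE eqxx !orbT.
have [L1 _ _] := D1; have [u D0] : exists g, L2deriv g (fun x => l1 * g x + g1 x).
  by apply: L2deriv_solve => //; apply: Re0; rewrite !inE eqxx.
by exists u; exact: chain_solution V D3 D2 D1 D0.
Qed.

(** For a = 0 the equation reads v' = f with v = u''' - u' - b u in L2. *)
Lemma H4_zero_mean b f u : cLp 2%:E f -> cLp 1%:E (fun x : R => x%:C * f x) ->
  H4_solution 0 b f u -> cintegral f = 0.
Proof.
move=> Lf /cL1_weight[iwr iwi] /H4_solutionP[u1 [u2 [u3 [u4 [Du D1 D2 D3 eqn]]]]].
have [Lr Li] := (cLp2P f).1 Lf.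
have lr := L2_locint Lr; have li := L2_locint Li.
have Dv := L2deriv_lin (-1) D1 D3; have {Dv} Dv := L2deriv_lin (- b%:C) Du Dv.
have [|/cLp2P[vr vi] _ /weak_derivative1P[wr wi]] := L2deriv_ae _ Lf Dv.
  by apply: ae_mono eqn => x <-; rewrite mul0r subr0; ring.
apply/cintegral0; split.
  exact: wderiv_mean0 vr lr (integrable_weight lr iwr) wr.
exact: wderiv_mean0 vi li (integrable_weight li iwi) wi.
Qed.

End FourthOrder.

Theorem theorem1p1 (R : realType) (a b : R) (f : R -> R[i])
    (ha : 0 <= a) (hb : b != 0) (hf : cLp 2%:E f) :
  (0 < a -> unique_ae (H4_solution a b f)) /\
  (a = 0 -> cLp 1%:E (fun x : R => x%:C * f x) ->
    (unique_ae (H4_solution a b f) <-> L2dot f (fun=> 1) = 0)).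
Proof.
have unique u : H4_solution a b f u -> unique_ae (H4_solution a b f).
  by move=> Hu; exists u; split=> // v Hv; exact: H4_unique Hu Hv.
split=> [a0|a0 hw]; first by have [u] := H4_exists_pos a0 hb hf; exact: unique.
rewrite L2dot1; split=> [[u [Hu _]]|f0].
  by apply: (@H4_zero_mean R b f u) => //; rewrite -a0.
by have [u] := H4_exists_zero hb hf hw f0; rewrite -a0; exact: unique.
Qed.
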